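(* Let $p>2$ be a prime, $\mathbf{k}=\mathbf{F}_p(x_{11},x_{12},x_{21},x_{22})$ (rational functions in four indeterminates), and let $V_3$ be the generic three-dimensional representation over $\mathbf{k}$ of $G=(\mathbf{Z}/p)^2=\langle e_1,e_2\rangle$, so that $G$ acts on $\mathbf{k}[V_3]=\mathbf{k}[x,y,z]$ by algebra automorphisms with $x\cdot e_i=x$, $y\cdot e_i=y+x_{1i}x$, $z\cdot e_i=z+2x_{1i}y+(x_{1i}^2+x_{2i})x$ for $i=1,2$. Let $f_1,f_2$ and $N_G(z)$ be as defined in the context. Then $\mathcal{B}=\{x,f_1,f_2,N_G(z)\}$ is a SAGBI basis for $\mathbf{k}[V_3]^G$ with respect to the graded reverse lexicographic order with $x<y<z$. Furthermore, there is a single relation among the generators, constructed by subducting $\gamma_{13}^pf_1^{p+2}-\gamma_{12}^2f_2^p$.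
   Context: Let $\delta=y^2-xz$. Let $\Gamma$ be the matrix with rows $(x_{11},x_{12})$, $(x_{21},x_{22})$, $(x_{11}^p,x_{12}^p)$, $(x_{21}^p,x_{22}^p)$ (rows $1$ to $4$), and let $\gamma_{ij}$ be the $2\times2$ minor of $\Gamma$ on rows $i<j$. Define $$f_1=\gamma_{12}y^p+\gamma_{13}\delta x^{p-2}+\gamma_{23}yx^{p-1},\qquad f_{124}=-\gamma_{12}\delta^p+\gamma_{14}\delta x^{2p-2}+\gamma_{24}yx^{2p-1},\qquad f_2=\frac{\gamma_{12}f_{124}+f_1^2}{2x^{p-2}},$$ where $f_2$ is a polynomial with lead term $\gamma_{12}\gamma_{13}y^{p+2}$. These are $G$-invariant. $N_G(z)$ is the product of the elements of the $G$-orbit of $z$. A subset $\mathcal{B}$ of a subalgebra $A$ of a polynomial ring is a SAGBI basis for $A$ if the lead monomials of the elements of $\mathcal{B}$ generate, as an algebra, the lead term algebra of $A$ (the algebra spanned by the lead monomials of nonzero elements of $A$); then $\mathcal{B}$ generates $A$. To subduct a polynomial $F$ over $\mathcal{B}$ is to repeatedly subtract from it scalar multiples of products of elements of $\mathcal{B}$ having the same lead term as the current polynomial; for a SAGBI basis, every $F\in A$ subducts to $0$. If $F$ is a polynomial expression in elements of $\mathcal{B}$, its subduction to $0$ yields an identity $F-\sum_I c_I\,b^I=0$ with products $b^I$ of elements of $\mathcal{B}$: this is the relation constructed by subducting $F$. ''A single relation'' means that the ideal of all algebraic relations among the listed generators is generated by that one relation. *)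

(* Defs.v *)
From HB Require Import structures.
From mathcomp Require Import all_boot all_order all_algebra.
From mathcomp Require Import mpoly.
From mathcomp Require Import zify ring.

Set Implicit Arguments.
Unset Strict Implicit.
Unset Printing Implicit Defensive.

Import GRing.Theory.

Local Open Scope ring_scope.

(* The variables are ordered 'X_0 < 'X_1 < 'X_2 < ...: among monomials of
   equal degree, the smaller one has the larger exponent at the smallest
   variable where they differ. This is not the order built into mpoly
   ([mlead]), which is graded lexicographic. *)
Definition grevlex_lt (n : nat) (m1 m2 : 'X_{1..n}) : bool :=
  (mdeg m1 < mdeg m2)%N ||
  (mdeg m1 == mdeg m2) &&
  [exists i : 'I_n,
     (m2 i < m1 i)%N && [forall j : 'I_n, (j < i)%N ==> (m1 j == m2 j)]].

(* This forces [F != 0]. *)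
Definition is_lead_monomial (K : fieldType) (n : nat)
    (F : {mpoly K[n]}) (m : 'X_{1..n}) : Prop :=
  m \in msupp F /\
  forall m' : 'X_{1..n}, m' \in msupp F -> m' != m -> grevlex_lt m' m.

Definition same_lead_term (K : fieldType) (n : nat)
    (F H : {mpoly K[n]}) : Prop :=
  exists m : 'X_{1..n},
    [/\ is_lead_monomial F m, is_lead_monomial H m & F@_m = H@_m].

Inductive lin_span (K : fieldType) (n : nat) (S : {mpoly K[n]} -> Prop) :
    {mpoly K[n]} -> Prop :=
| LinSpan0 : lin_span S 0
| LinSpanD (c : K) (F H : {mpoly K[n]}) :
    S F -> lin_span S H -> lin_span S (c *: F + H).

Inductive alg_gen (K : fieldType) (n : nat) (S : {mpoly K[n]} -> Prop) :
    {mpoly K[n]} -> Prop :=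
| AlgGenIn (F : {mpoly K[n]}) : S F -> alg_gen S F
| AlgGenC (c : K) : alg_gen S c%:MP
| AlgGenD (F H : {mpoly K[n]}) :
    alg_gen S F -> alg_gen S H -> alg_gen S (F + H)
| AlgGenM (F H : {mpoly K[n]}) :
    alg_gen S F -> alg_gen S H -> alg_gen S (F * H).

Definition lead_monomials (K : fieldType) (n : nat)
    (A : {mpoly K[n]} -> Prop) (P : {mpoly K[n]}) : Prop :=
  exists (F : {mpoly K[n]}) (m : 'X_{1..n}),
    [/\ A F, is_lead_monomial F m & P = 'X_[m]].

Definition lead_term_algebra (K : fieldType) (n : nat)
    (A : {mpoly K[n]} -> Prop) : {mpoly K[n]} -> Prop :=
  lin_span (lead_monomials A).

Definition is_sagbi_basis (K : fieldType) (n : nat)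
    (A : {mpoly K[n]} -> Prop) (B : seq {mpoly K[n]}) : Prop :=
  (forall F : {mpoly K[n]}, F \in B -> A F) /\
  (forall P : {mpoly K[n]},
     alg_gen (lead_monomials (fun F => F \in B)) P <-> lead_term_algebra A P).

(* [subducts b F T H]: some number of subduction steps over b lead from F to
   H, the sum of the subtracted terms c * b^I being the value at b of the
   polynomial T (so F - T(b) = H). *)
Inductive subducts (K : fieldType) (n r : nat) (b : r.-tuple {mpoly K[n]}) :
    {mpoly K[n]} -> {mpoly K[r]} -> {mpoly K[n]} -> Prop :=
| SubductsRefl (F : {mpoly K[n]}) : subducts b F 0 F
| SubductsStep (F H : {mpoly K[n]}) (T : {mpoly K[r]})
    (c : K) (I : 'X_{1..r}) :
    same_lead_term F (c *: ('X_[I] \mPo b)) ->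
    subducts b (F - c *: ('X_[I] \mPo b)) T H ->
    subducts b F (c *: 'X_[I] + T) H.

(* [P] is a polynomial expression in the elements of b, and [R] is a relation
   obtained by subducting its value P(b) to 0. *)
Definition subduction_relation (K : fieldType) (n r : nat)
    (b : r.-tuple {mpoly K[n]}) (P R : {mpoly K[r]}) : Prop :=
  exists T : {mpoly K[r]}, subducts b (P \mPo b) T 0 /\ R = P - T.

Definition generates_relations (K : fieldType) (n r : nat)
    (b : r.-tuple {mpoly K[n]}) (R : {mpoly K[r]}) : Prop :=
  forall Q : {mpoly K[r]},
    Q \mPo b = 0 <-> exists S : {mpoly K[r]}, Q = S * R.

Definition mdivX (K : fieldType) (n : nat) (i : 'I_n) (k : nat)
    (F : {mpoly K[n]}) : {mpoly K[n]} :=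
  \sum_(m <- msupp F) F@_m *: 'X_[m - U_(i) *+ k].

Lemma mdivX_mul (K : fieldType) (n : nat) (i : 'I_n) (k : nat)
    (F : {mpoly K[n]}) : mdivX i k (F * 'X_i ^+ k) = F.
Proof.
rewrite /mdivX mpolyXn (perm_big _ (msuppMX F (U_(i) *+ k)%MM)) big_map /=.
rewrite [RHS]mpolyE; apply: eq_bigr => m _.
by rewrite mcoeffMX addmC addmK.
Qed.

(* K[x, y, z]; the indices make x < y < z in [grevlex_lt]. *)
Definition xV (K : fieldType) : {mpoly K[3]} := 'X_0.
Definition yV (K : fieldType) : {mpoly K[3]} := 'X_1.
Definition zV (K : fieldType) : {mpoly K[3]} := 'X_2.
Arguments xV {K}.
Arguments yV {K}.
Arguments zV {K}.

(* In what follows X is the matrix (x_ij), over any field of characteristic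
   p; the generic representation is the case X = [xgen p]. *)

(* The algebra automorphism F |-> F . e_(i+1). *)
Definition act_gen (K : fieldType) (X : 'M[K]_2) (i : 'I_2)
    (F : {mpoly K[3]}) : {mpoly K[3]} :=
  F \mPo [tuple xV;
                yV + X 0 i *: xV;
                zV + (2 * X 0 i) *: yV + (X 0 i ^+ 2 + X 1 i) *: xV].

(* The right action of (Z/p)^2, with (c_1, c_2) = c_1 e_1 + c_2 e_2; see
   [act0] and [actD]. *)
Definition act (K : fieldType) (p : nat) (X : 'M[K]_2) (F : {mpoly K[3]})
    (g : 'Z_p * 'Z_p) : {mpoly K[3]} :=
  iter g.2 (act_gen X 1) (iter g.1 (act_gen X 0) F).

Definition G_invariant (K : fieldType) (p : nat) (X : 'M[K]_2)
    (F : {mpoly K[3]}) : Prop :=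
  forall g : 'Z_p * 'Z_p, act X F g = F.

(* [undup]: the product is over the orbit as a set. *)
Definition NGz (K : fieldType) (p : nat) (X : 'M[K]_2) : {mpoly K[3]} :=
  \prod_(F <- undup [seq act X zV g | g : 'Z_p * 'Z_p]) F.

Definition Gam (K : fieldType) (p : nat) (X : 'M[K]_2) : 'M[K]_(2 + 2, 2) :=
  col_mx X (map_mx (fun a => a ^+ p) X).

(* Rows are numbered from 0: gamma_{ij} in one-based notation is
   [gam p X (i - 1) (j - 1)]. *)
Definition gam (K : fieldType) (p : nat) (X : 'M[K]_2) (i j : 'I_4) : K :=
  \det (rowsub (fun r : 'I_2 => if r == 0 then i else j) (Gam p X)).

Definition delta (K : fieldType) : {mpoly K[3]} := yV ^+ 2 - xV * zV.
Arguments delta {K}.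

Definition f1 (K : fieldType) (p : nat) (X : 'M[K]_2) : {mpoly K[3]} :=
  gam p X 0 1 *: yV ^+ p
  + gam p X 0 2 *: (delta * xV ^+ (p - 2))
  + gam p X 1 2 *: (yV * xV ^+ (p - 1)).

Definition f124 (K : fieldType) (p : nat) (X : 'M[K]_2) : {mpoly K[3]} :=
  - (gam p X 0 1 *: delta ^+ p)
  + gam p X 0 3 *: (delta * xV ^+ (2 * p - 2))
  + gam p X 1 3 *: (yV * xV ^+ (2 * p - 1)).

(* (gamma_12 f_124 + f_1^2) / (2 x^(p-2)); the division is exact, see
   [f2_exact]. *)
Definition f2 (K : fieldType) (p : nat) (X : 'M[K]_2) : {mpoly K[3]} :=
  2^-1 *: mdivX 0 (p - 2) (gam p X 0 1 *: f124 p X + f1 p X ^+ 2).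

Definition gens (K : fieldType) (p : nat) (X : 'M[K]_2) :
    4.-tuple {mpoly K[3]} :=
  [tuple xV; f1 p X; f2 p X; NGz p X].

(* gamma_13^p f_1^(p+2) - gamma_12^2 f_2^p as a formal expression: 'X_1 and
   'X_2 stand for f_1 and f_2 in [gens]. *)
Definition tete (K : fieldType) (p : nat) (X : 'M[K]_2) : {mpoly K[4]} :=
  gam p X 0 2 ^+ p *: 'X_1 ^+ (p + 2) - gam p X 0 1 ^+ 2 *: 'X_2 ^+ p.

Definition kgen (p : nat) : fieldType := {fraction {mpoly 'F_p[2 * 2]}}.

(* Indices from 0: the (i, j) entry is the indeterminate x_{i+1,j+1}. *)
Definition xgen (p : nat) : 'M[kgen p]_2 :=
  \matrix_(i, j) tofrac 'X_(mxvec_index i j).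

Lemma pchar_kgen (p : nat) : prime p -> p \in [pchar kgen p].
Proof.
move=> p_pr; have h : p \in [pchar 'F_p] by apply: pchar_Fp.
have h1 : p \in [pchar {mpoly 'F_p[2 * 2]}].
  exact: (rmorph_pchar (mpolyC (2 * 2) (R := 'F_p)) h).
exact: (rmorph_pchar (@tofrac {mpoly 'F_p[2 * 2]}) h1).
Qed.

Lemma f2_identity (R : comNzRingType) (g12 g13 g23 g14 g24 x y d Y Z : R)
    (p : nat) : (1 < p)%N ->
  g12 * (- (g12 * (Y ^+ 2 - x ^+ p * Z)) + g14 * (d * x ^+ (2 * p - 2))
         + g24 * (y * x ^+ (2 * p - 1)))
  + (g12 * Y + g13 * (d * x ^+ (p - 2)) + g23 * (y * x ^+ (p - 1))) ^+ 2 =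
  (g12 ^+ 2 * x ^+ 2 * Z + g12 * g14 * d * x ^+ p + g12 * g24 * y * x ^+ p.+1
   + 2 * g12 * Y * (g13 * d + g23 * y * x)
   + x ^+ (p - 2) * (g13 * d + g23 * y * x) ^+ 2) * x ^+ (p - 2).
Proof.
case: p => [|[|q]] // _.
have -> : (2 * q.+2 - 2 = q + q + 2)%N by lia.
have -> : (2 * q.+2 - 1 = q + q + 3)%N by lia.
have -> : (q.+2 - 1 = q + 1)%N by lia.
have -> : (q.+2 - 2 = q)%N by lia.
rewrite !exprD !exprS; ring.
Qed.

Lemma f2_exact (K : fieldType) (p : nat) (X : 'M[K]_2) :
  p \in [pchar K] -> (2 < p)%N ->
  2 *: (xV ^+ (p - 2) * f2 p X) = gam p X 0 1 *: f124 p X + f1 p X ^+ 2.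
Proof.
move=> pK p_gt2; set N := _ + f1 p X ^+ 2.
have n2 : (2 : K) != 0.
  rewrite -(dvdn_pcharf pK); apply/negP => h.
  by move: (dvdn_leq (isT : (0 < 2)%N) h); rewrite leqNgt p_gt2.
suff [Q hQ] : exists Q, N = Q * xV ^+ (p - 2).
  by rewrite /f2 -/N hQ mdivX_mul -scalerAr scalerA divff // scale1r mulrC.
have pV : p \in [pchar {mpoly K[3]}] := rmorph_pchar (mpolyC 3 (R := K)) pK.
have hd : delta ^+ p = yV ^+ p ^+ 2 - xV ^+ p * zV ^+ p :> {mpoly K[3]}.
  have hB (u v : {mpoly K[3]}) : (u - v) ^+ p = u ^+ p - v ^+ p.
    exact: (rmorphB (pFrobenius_aut pV)).
  by rewrite /delta hB (exprMn p xV) exprAC.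
rewrite /N /f124 hd /f1 -!mul_mpolyC.
by eexists; apply: f2_identity; apply: ltnW.
Qed.

Lemma comp_mpoly_comp (K : fieldType) (n k l : nat)
    (s : n.-tuple {mpoly K[k]}) (t : k.-tuple {mpoly K[l]})
    (u : n.-tuple {mpoly K[l]}) (F : {mpoly K[n]}) :
  (forall i, tnth s i \mPo t = tnth u i) -> (F \mPo s) \mPo t = F \mPo u.
Proof.
move=> stu; rewrite [F]mpolyE (raddf_sum (comp_mpoly s)) (raddf_sum (comp_mpoly u)).
rewrite /= (raddf_sum (comp_mpoly t)); apply: eq_bigr => m _ /=.
rewrite !comp_mpolyZ !comp_mpolyX rmorph_prod /=; congr (_ *: _).
by apply: eq_bigr => i _; rewrite rmorphXn /= stu.
Qed.

Lemma act0 (K : fieldType) (p : nat) (X : 'M[K]_2) (F : {mpoly K[3]}) :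
  act X F (0 : 'Z_p * 'Z_p) = F.
Proof. by []. Qed.

Lemma actD (K : fieldType) (p : nat) (X : 'M[K]_2) (F : {mpoly K[3]})
    (g h : 'Z_p * 'Z_p) :
  p \in [pchar K] -> act X F (g + h) = act X (act X F g) h.
Proof.
move=> pK.
pose s (a b : K) := [tuple xV; yV + a *: xV;
                zV + (2 * a) *: yV + (a ^+ 2 + b) *: xV].
have sD a b c d E : (E \mPo s a b) \mPo s c d = E \mPo s (a + c) (b + d).
  apply: comp_mpoly_comp => i.
  case: i => -[|[|[|//]]] lti; rewrite !(tnth_nth 0) /=;
    rewrite ?comp_mpolyD ?comp_mpolyZ !comp_mpolyXU /= -?mul_mpolyC;
    rewrite ?rmorphD ?rmorphM ?rmorphXn ?rmorph_nat //=; ring.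
have s0 E : E \mPo s 0 0 = E.
  rewrite -[RHS]comp_mpoly_id; congr (_ \mPo _); apply: eq_from_tnth => i.
  rewrite tnth_mktuple; case: i => -[|[|[|//]]] lti; rewrite (tnth_nth 0) /=;
    rewrite ?mulr0 ?expr0n /= ?addr0 ?scale0r ?addr0;
    by congr 'X_[U_(_)]; apply: val_inj.
have sX i k E : iter k (act_gen X i) E
    = E \mPo s (X 0 i *+ k) (X 1 i *+ k).
  elim: k => [|k IH]; first by rewrite !mulr0n s0.
  by rewrite iterS IH !mulrSr -sD.
have pD (a : K) (u v : 'Z_p) : a *+ (u + v)%R = a *+ u + a *+ v.
  rewrite -mulrnDr -[in LHS]mulr_natr -[RHS]mulr_natr /=; congr (_ * _).
  move: (nat_of_ord u + nat_of_ord v)%N => w.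
  rewrite Zp_cast ?prime_gt1 ?(pcharf_prime pK) //.
  by rewrite [in RHS](divn_eq w p) natrD natrM (pcharf0 pK) mulr0 add0r.
have hAC (a b c d : K) : a + b + (c + d) = a + (c + (b + d)) by ring.
by rewrite /act 6!sX 4!sD !pD (hAC (X 0 0 *+ _)) (hAC (X 1 0 *+ _)).
Qed.

(* Main.v *)
(** In the chart y = x Y, z = x zeta(u, Y), where u = f_1 on x = 1, the group
    fixes x and u and translates Y by the p^2 distinct elements of the lattice
    spanned by x_11 and x_12. In this chart f_2 and N_G(z) become, up to powers
    of x, invariants of Y-degree p^2 and p^3 with invertible lead coefficients.
    An invariant of Y-degree less than p^2 does not involve Y (count roots), so
    division by f_2^j N^k, j < p, shows that for every invariant F some x^n F
    is a combination of the products x^a f_1^i f_2^j N^k with j < p. The lead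
    monomials y^p, y^(p+2), z^(p^2) of f_1, f_2, N make the lead monomials of
    these products pairwise distinct, because p + 2 is invertible mod p. Hence
    the lead monomial of x^n F, and so that of F, is a product of lead
    monomials of generators. A relation obtained by subduction has, as a
    polynomial in f_2, degree p and constant lead coefficient; a relation
    reduced modulo it involves only products with distinct lead monomials, so
    it is zero. *)

From HB Require Import structures.
Require Import Defs.
From mathcomp Require Import all_boot all_order all_algebra.
From mathcomp Require Import mpoly.
From mathcomp Require Import zify ring.

Import GRing.Theory.

Local Open Scope ring_scope.

(** * Graded reverse lexicographic order *)

Section Grevlex.
Context {n : nat}.
Implicit Types m : 'X_{1..n}.

(** In a fixed degree the smaller monomial has the larger exponent at the first difference, so the
    order is there the converse of the built-in one, whose order laws can be reused. *)
Lemma grevlex_ltE m1 m2 :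
  grevlex_lt m1 m2 =
  (mdeg m1 < mdeg m2)%N || (mdeg m1 == mdeg m2) && (m2 < m1)%O.
Proof.
rewrite /grevlex_lt; case: ltngtP => //= /eqP; rewrite eq_sym => /eqP dE.
apply/existsP/(ltmcP dE) => [[i /andP[lt_i /forallP eq_i]]|[i eq_i lt_i]].
  by exists i => // j lt_ji; apply/esym/eqP/(implyP (eq_i j)).
exists i; rewrite lt_i; apply/forallP => j; apply/implyP => lt_ji.
by rewrite eq_i.
Qed.

Lemma grevlex_irr m : grevlex_lt m m = false.
Proof. by rewrite grevlex_ltE ltnn Order.POrderTheory.ltxx andbF. Qed.

Lemma grevlex_trans m2 m1 m3 :
  grevlex_lt m1 m2 -> grevlex_lt m2 m3 -> grevlex_lt m1 m3.
Proof.
rewrite !grevlex_ltE => /orP[lt12|/andP[/eqP-> lt12]].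
  case/orP => [lt23|/andP[/eqP<- _]]; last by rewrite lt12.
  by rewrite (ltn_trans lt12 lt23).
case/orP => [->//|/andP[/eqP-> lt23]].
by rewrite eqxx (Order.POrderTheory.lt_trans lt23 lt12) orbT.
Qed.

Lemma grevlex_total m1 m2 : m1 != m2 -> grevlex_lt m1 m2 || grevlex_lt m2 m1.
Proof.
rewrite !grevlex_ltE; case: ltngtP => //= _.
by rewrite Order.TotalTheory.neq_lt orbC.
Qed.

Lemma grevlex_add2l m m1 m2 :
  grevlex_lt (m + m1)%MM (m + m2)%MM = grevlex_lt m1 m2.
Proof. by rewrite !grevlex_ltE !mdegD ltn_add2l eqn_add2l ltmc_add2r. Qed.

Lemma grevlex_add2r m m1 m2 :
  grevlex_lt (m1 + m)%MM (m2 + m)%MM = grevlex_lt m1 m2.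
Proof. by rewrite -!(addmC m) grevlex_add2l. Qed.

Definition grevlex_le m1 m2 := (m1 == m2) || grevlex_lt m1 m2.

Lemma grevlex_le_lt_trans m2 m1 m3 :
  grevlex_le m1 m2 -> grevlex_lt m2 m3 -> grevlex_lt m1 m3.
Proof. by case/orP => [/eqP->|]; [|apply: grevlex_trans]. Qed.

Lemma grevlex_lt_le_trans m2 m1 m3 :
  grevlex_lt m1 m2 -> grevlex_le m2 m3 -> grevlex_lt m1 m3.
Proof. by move=> lt12 /orP[/eqP<-//|]; apply: grevlex_trans. Qed.

Lemma grevlex_le_trans m2 m1 m3 :
  grevlex_le m1 m2 -> grevlex_le m2 m3 -> grevlex_le m1 m3.
Proof.
move=> le12 /orP[/eqP<-//|lt23].
by rewrite /grevlex_le (grevlex_le_lt_trans _ _ _ le12 lt23) orbT.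
Qed.

Lemma grevlex_le_addr m m' : grevlex_le m (m + m')%MM.
Proof.
have [->|m'0] := eqVneq m' 0%MM; first by rewrite addm0 /grevlex_le eqxx.
rewrite /grevlex_le grevlex_ltE mdegD -[X in (X < _)%N]addn0 ltn_add2l lt0n.
by rewrite mdeg_eq0 m'0 orbT.
Qed.

Lemma grevlex_max (s : seq 'X_{1..n}) :
  s != [::] -> exists2 m, m \in s & {in s, forall m', grevlex_le m' m}.
Proof.
elim: s => // m s IH _; have [->|/IH[m1 m1s max_m1]] := eqVneq s [::].
  exists m; rewrite ?inE ?eqxx // => m'; rewrite inE => /eqP->;
  by rewrite /grevlex_le eqxx.
have [le_m|] := boolP (grevlex_le m m1).
  exists m1; rewrite ?inE ?m1s ?orbT // => m'; rewrite inE => /orP[/eqP->//|].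
  exact: max_m1.
rewrite negb_or => /andP[/grevlex_total /orP[->//|lt_m1] _].
exists m; rewrite ?inE ?eqxx // => m'; rewrite inE => /orP[/eqP->|m's].
  by rewrite /grevlex_le eqxx.
by rewrite /grevlex_le (grevlex_le_lt_trans _ _ _ (max_m1 _ m's) lt_m1) orbT.
Qed.

(** A graded order has only finitely many monomials below [m], all of degree at most [mdeg m];
    counting them turns descent along the order into induction on natural numbers. *)
Definition grevlex_rank m : nat :=
  #|[pred m' : 'X_{1..n < (mdeg m).+1} | grevlex_lt m' m]|.

(** Transitivity embeds the monomials below [m1] into those below [m2], and [m1] itself is missed by
    this embedding. *)
Lemma grevlex_rank_lt m1 m2 :
  grevlex_lt m1 m2 -> (grevlex_rank m1 < grevlex_rank m2)%N.
Proof.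
move=> lt12; have le12 : (mdeg m1 < (mdeg m2).+1)%N.
  by move: lt12; rewrite grevlex_ltE ltnS => /orP[/ltnW//|/andP[/eqP->]].
pose h (m : 'X_{1..n < (mdeg m1).+1}) : 'X_{1..n < (mdeg m2).+1} :=
  BMultinom (leq_trans (bmdeg m) le12).
have h_inj : injective h by move=> a b [] /val_inj.
rewrite /grevlex_rank -(card_image h_inj).
apply: (proper_card (A := mem (image h _))).
apply/properP; split.
  apply/subsetP => _ /imageP[m /= lt_m ->]; rewrite inE /=.
  exact: grevlex_trans lt_m lt12.
exists (BMultinom le12); rewrite ?inE //=; apply/imageP => -[m].
by rewrite inE => lt_m [mE]; rewrite -mE grevlex_irr in lt_m.
Qed.

End Grevlex.

(** * Bounds on supports, and lead monomials of sums and products *)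

Section SupportBounds.
Context {K : fieldType} {n : nat}.
Implicit Types (F H : {mpoly K[n]}) (m : 'X_{1..n}).

(** Upper bounds on the support. Unlike [is_lead_monomial], neither this nor [supp_le] asks for a
    nonzero coefficient at [m], so both survive sums in which top terms cancel. *)
Definition supp_lt F m := {in msupp F, forall m', grevlex_lt m' m}.
Definition supp_le F m := {in msupp F, forall m', grevlex_le m' m}.

Lemma supp_lt_le F m : supp_lt F m -> supp_le F m.
Proof. by move=> lt_F m' /lt_F; rewrite /grevlex_le => ->; rewrite orbT. Qed.

Lemma supp_lt_coeff F m : supp_lt F m -> F@_m = 0.
Proof.
move=> lt_F; apply/eqP; rewrite mcoeff_eq0; apply/negP => /lt_F.
by rewrite grevlex_irr.
Qed.

Lemma supp_ltP F m : supp_lt F m <-> supp_le F m /\ F@_m = 0.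
Proof.
split=> [lt_F|[le_F F0] m' m'F].
  by split; [apply: supp_lt_le | apply: supp_lt_coeff].
case/orP: (le_F _ m'F) => // /eqP mE.
by rewrite mE mcoeff_msupp F0 eqxx in m'F.
Qed.

Lemma supp_lt_trans F m1 m2 : supp_le F m1 -> grevlex_lt m1 m2 -> supp_lt F m2.
Proof. by move=> le_F lt12 m /le_F le_m; apply: grevlex_le_lt_trans lt12. Qed.

Lemma supp_leD F H m : supp_le F m -> supp_le H m -> supp_le (F + H) m.
Proof.
by move=> le_F le_H m' /msuppD_le; rewrite mem_cat => /orP[/le_F|/le_H].
Qed.

Lemma supp_leZ c F m : supp_le F m -> supp_le (c *: F) m.
Proof. by move=> le_F m' /msuppZ_le /le_F. Qed.

Lemma supp_le_sum (I : eqType) (s : seq I) (E : I -> {mpoly K[n]}) m :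
  {in s, forall i, supp_le (E i) m} -> supp_le (\sum_(i <- s) E i) m.
Proof.
move=> le_E; rewrite big_seq; apply: (big_ind (fun F => supp_le F m)) => //.
  by move=> m'; rewrite msupp0.
by move=> F H; apply: supp_leD.
Qed.

Lemma supp_leX m : supp_le 'X_[m] m.
Proof. by move=> m'; rewrite msuppX inE /grevlex_le => ->. Qed.

Lemma supp_le_split F m :
  supp_le F m -> exists2 H, F = F@_m *: 'X_[m] + H & supp_lt H m.
Proof.
move=> le_F; exists (F - F@_m *: 'X_[m]); first by rewrite addrC subrK.
apply/supp_ltP; split; last by rewrite mcoeffB mcoeffZ mcoeffX eqxx mulr1 subrr.
by rewrite -scaleNr; apply: supp_leD => //; apply/supp_leZ/supp_leX.
Qed.

Lemma supp_leM F H m1 m2 :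
  supp_le F m1 -> supp_le H m2 -> supp_le (F * H) (m1 + m2)%MM.
Proof.
move=> le_F le_H m /msuppM_le/allpairsP[[a b] /= [/le_F le_a /le_H le_b ->]].
apply: (grevlex_le_trans (m1 + b)%MM).
  by rewrite /grevlex_le eqm_add2r grevlex_add2r.
by rewrite /grevlex_le eqm_add2l grevlex_add2l.
Qed.

Lemma supp_ltM F H m1 m2 :
  supp_lt F m1 -> supp_le H m2 -> supp_lt (F * H) (m1 + m2)%MM.
Proof.
move=> lt_F le_H m /msuppM_le/allpairsP[[a b] /= [/lt_F lt_a /le_H le_b ->]].
apply: (grevlex_lt_le_trans (m1 + b)%MM); first by rewrite grevlex_add2r.
by rewrite /grevlex_le eqm_add2l grevlex_add2l.
Qed.

(** Only the product of the two top terms reaches [m1 + m2]: the rest of [F] lies strictly below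
    [m1], so its product with [H] lies strictly below the sum. *)
Lemma mcoeffM_supp_le F H m1 m2 : supp_le F m1 -> supp_le H m2 ->
  (F * H)@_(m1 + m2) = F@_m1 * H@_m2.
Proof.
move=> le_F le_H; have [F' FE lt_F'] := supp_le_split F m1 le_F.
rewrite {1}FE mulrDl mcoeffD -scalerAl mcoeffZ ['X_[_] * H]mulrC mcoeffMX.
by rewrite (supp_lt_coeff (F' * H)) ?addr0 //; apply: supp_ltM.
Qed.

Lemma is_lead_suppP F m :
  is_lead_monomial F m <-> F@_m != 0 /\ supp_le F m.
Proof.
rewrite /is_lead_monomial mcoeff_msupp; split=> -[Fm le_F]; split=> // m' m'F.
  by rewrite /grevlex_le; case: eqVneq => //= /le_F; apply.
by move=> ne_m; have := le_F _ m'F; rewrite /grevlex_le (negPf ne_m).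
Qed.

Lemma is_lead_exists F : F != 0 -> exists m, is_lead_monomial F m.
Proof.
rewrite -msupp_eq0 => /grevlex_max[m mF le_m].
by exists m; apply/is_lead_suppP; rewrite -mcoeff_msupp.
Qed.

Lemma is_lead_uniq F m1 m2 :
  is_lead_monomial F m1 -> is_lead_monomial F m2 -> m1 = m2.
Proof.
move=> [m1F lt1] [m2F lt2]; have [//|ne12] := eqVneq m1 m2.
have := grevlex_trans _ _ _ (lt2 _ m1F ne12) (lt1 _ m2F _).
by rewrite grevlex_irr eq_sym; move/(_ ne12).
Qed.

Lemma is_lead_neq0 F m : is_lead_monomial F m -> F != 0.
Proof.
by case=> mF _; apply: contraTneq mF => ->; rewrite msupp0.
Qed.

Lemma is_leadX m : is_lead_monomial ('X_[m] : {mpoly K[n]}) m.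
Proof.
apply/is_lead_suppP; rewrite mcoeffX eqxx oner_neq0; split=> //.
exact: supp_leX.
Qed.

Lemma is_lead1 : is_lead_monomial (1 : {mpoly K[n]}) 0%MM.
Proof. by rewrite -mpolyX0; apply: is_leadX. Qed.

Lemma is_leadZ c F m :
  c != 0 -> is_lead_monomial F m -> is_lead_monomial (c *: F) m.
Proof.
move=> c0 /is_lead_suppP[Fm le_F]; apply/is_lead_suppP.
by rewrite mcoeffZ mulf_neq0 //; split=> //; apply: supp_leZ.
Qed.

Lemma is_leadM F H m1 m2 : is_lead_monomial F m1 -> is_lead_monomial H m2 ->
  is_lead_monomial (F * H) (m1 + m2)%MM.
Proof.
move=> /is_lead_suppP[Fm le_F] /is_lead_suppP[Hm le_H]; apply/is_lead_suppP.
by rewrite mcoeffM_supp_le // mulf_neq0 //; split=> //; apply: supp_leM.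
Qed.

Lemma is_lead_exp F m k :
  is_lead_monomial F m -> is_lead_monomial (F ^+ k) (m *+ k)%MM.
Proof.
move=> lead_F; elim: k => [|k IH]; first by rewrite mulm0n; apply: is_lead1.
by rewrite exprS mulmS; apply: is_leadM.
Qed.

Lemma is_lead_prod (I : Type) (s : seq I) (E : I -> {mpoly K[n]})
    (e : I -> 'X_{1..n}) :
  (forall i, is_lead_monomial (E i) (e i)) ->
  is_lead_monomial (\prod_(i <- s) E i) (\big[+%MM/0%MM]_(i <- s) e i).
Proof.
move=> lead_E; elim: s => [|i s IH]; first by rewrite !big_nil; apply: is_lead1.
by rewrite !big_cons; apply: is_leadM.
Qed.

Lemma supp_lt_reduce F H m : supp_le F m -> is_lead_monomial H m ->
  exists2 c, supp_lt (F - c *: H) m & F@_m = (c *: H)@_m.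
Proof.
move=> le_F /is_lead_suppP[Hm le_H]; exists (F@_m / H@_m); last first.
  by rewrite mcoeffZ divfK.
apply/supp_ltP; rewrite mcoeffB mcoeffZ divfK // subrr; split=> //.
by rewrite -scaleNr; apply: supp_leD => //; apply: supp_leZ.
Qed.

End SupportBounds.

(** * Subduction and relations *)

Section Subduction.
Context {K : fieldType} {n r : nat} {b : r.-tuple {mpoly K[n]}}.
Context {l : 'I_r -> 'X_{1..n}}.
Hypothesis lead_b : forall i, is_lead_monomial (tnth b i) (l i).
Implicit Types (I : 'X_{1..r}) (F : {mpoly K[n]}) (Q : {mpoly K[r]}).

Definition lead_exp I : 'X_{1..n} := (\sum_(i < r) l i *+ I i)%MM.

Lemma lead_expD I J : lead_exp (I + J)%MM = (lead_exp I + lead_exp J)%MM.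
Proof.
rewrite /lead_exp -big_split; apply: eq_bigr => i _.
by apply/mnmP => j; rewrite !(mnmDE, mulmnE) mulnDr.
Qed.

Lemma lead_exp_monomial I : is_lead_monomial ('X_[I] \mPo b) (lead_exp I).
Proof.
rewrite comp_mpolyX; apply: is_lead_prod => i.
exact/is_lead_exp/lead_b.
Qed.

(** The largest of the lead monomials of the products occurring in [Q] is attained by a single
    product, by injectivity, so no other term can cancel it. *)
Lemma lead_exp_comb Q : {in msupp Q &, injective lead_exp} -> Q != 0 ->
  exists2 I, I \in msupp Q & is_lead_monomial (Q \mPo b) (lead_exp I).
Proof.
move=> inj_exp Q0; have [|m /mapP[I IQ ->] max_I] :=
    grevlex_max [seq lead_exp J | J <- msupp Q].
  by rewrite -size_eq0 size_map size_eq0 msupp_eq0.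
have le_I J : J \in msupp Q -> supp_le ('X_[J] \mPo b) (lead_exp I).
  move=> JQ m' m'J; have /is_lead_suppP[_ le_J] := lead_exp_monomial J.
  exact: grevlex_le_trans (le_J _ m'J) (max_I _ (map_f _ JQ)).
exists I => //; apply/is_lead_suppP; rewrite comp_mpolyEX; split; last first.
  by apply: supp_le_sum => J JQ; apply/supp_leZ/le_I.
have /is_lead_suppP[I0 _] := lead_exp_monomial I.
rewrite raddf_sum (bigD1_seq I) //= big_seq_cond big1 ?addr0.
  by rewrite mcoeffZ mulf_neq0 // -mcoeff_msupp.
move=> J /andP[JQ ne_JI]; rewrite mcoeffZ.
rewrite (supp_lt_coeff ('X_[J] \mPo b)) ?mulr0 // => m' m'J.
have /is_lead_suppP[_ le_J] := lead_exp_monomial J.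
apply: grevlex_le_lt_trans (le_J _ m'J) _.
have /orP[/eqP/inj_exp JI|//] := max_I _ (map_f lead_exp JQ).
by rewrite JI ?eqxx in ne_JI.
Qed.

Lemma subducts_comp F Q H : subducts b F Q H -> Q \mPo b = F - H.
Proof.
elim=> [F'|F' H' T c I _ _ IH]; first by rewrite comp_mpoly0 subrr.
by rewrite comp_mpolyD comp_mpolyZ IH addrA [_ + (F' - _)]addrC subrK.
Qed.

(** Each subtracted product has the lead monomial of the current polynomial, and a subtraction never
    raises the support, so a bound on [F] passes to all products recorded in [Q]. *)
Lemma subducts_supp_lt F Q H m : subducts b F Q H -> supp_lt F m ->
  {in msupp Q, forall I, grevlex_lt (lead_exp I) m}.
Proof.
elim=> [F' _ I|F' H' T c I [m' [lead_F lead_I Fm']] _ IH lt_F J].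
  by rewrite msupp0.
have c0 : c != 0.
  by have := is_lead_neq0 _ _ lead_I; apply: contraNneq => ->; rewrite scale0r.
have m'E := is_lead_uniq _ _ _ lead_I (is_leadZ _ _ _ c0 (lead_exp_monomial I)).
have lt_m' : grevlex_lt m' m by case: lead_F => m'F _; apply: lt_F.
move=> /msuppD_le; rewrite mem_cat => /orP[/msuppZ_le|].
  by rewrite msuppX inE => /eqP->; rewrite -m'E.
apply: IH; apply: (supp_lt_trans _ m') => //; rewrite -scaleNr.
apply: supp_leD; first by case/is_lead_suppP: lead_F.
have /is_lead_suppP[_] := lead_exp_monomial I.
by rewrite -m'E; apply: supp_leZ.
Qed.

(** * SAGBI bases and subduction to zero in a subalgebra *)

Section Subalgebra.
Variable A : {mpoly K[n]} -> Prop.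
Hypothesis AC : forall c, A c%:MP.
Hypothesis AD : forall F H, A F -> A H -> A (F + H).
Hypothesis AM : forall F H, A F -> A H -> A (F * H).
Hypothesis Ab : forall i, A (tnth b i).
Hypothesis A_lead : forall F m,
  A F -> is_lead_monomial F m -> exists I, m = lead_exp I.

Lemma subalgebra_comp Q : A (Q \mPo b).
Proof.
have AZ c F : A F -> A (c *: F) by rewrite -mul_mpolyC; apply: AM.
have A1 : A 1 by rewrite -mpolyC1.
have AX F k : A F -> A (F ^+ k).
  by move=> AF; elim: k => [|k IH]; rewrite ?exprS //; apply: AM.
rewrite comp_mpolyE; apply: (big_ind A) => [|//|I _].
  by rewrite -mpolyC0.
by apply/AZ/(big_ind A) => // i _; apply/AX/Ab.
Qed.

Lemma lead_mul_closed P P' :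
  lead_monomials A P -> lead_monomials A P' -> lead_monomials A (P * P').
Proof.
move=> [F [m [AF lead_F ->]]] [H [m' [AH lead_H ->]]].
exists (F * H), (m + m')%MM; rewrite mpolyXD; split=> //; first exact: AM.
exact: is_leadM.
Qed.

Lemma lin_spanD (S : {mpoly K[n]} -> Prop) P P' :
  lin_span S P -> lin_span S P' -> lin_span S (P + P').
Proof.
move=> spP spP'; elim: spP => [|c F H SF _ IH]; first by rewrite add0r.
by rewrite -addrA; apply: LinSpanD.
Qed.

Lemma lin_spanZ (S : {mpoly K[n]} -> Prop) c P :
  lin_span S P -> lin_span S (c *: P).
Proof.
elim=> [|d F H SF _ IH]; first by rewrite scaler0; apply: LinSpan0.
by rewrite scalerDr scalerA; apply: LinSpanD.
Qed.

Lemma lin_span_in (S : {mpoly K[n]} -> Prop) P : S P -> lin_span S P.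
Proof.
by move=> SP; rewrite -[P]addr0 -[P]scale1r; apply/LinSpanD/LinSpan0.
Qed.

Lemma lin_spanM P P' : lead_term_algebra A P -> lead_term_algebra A P' ->
  lead_term_algebra A (P * P').
Proof.
move=> + spP'; elim=> [|c F H SF _ IH]; first by rewrite mul0r; apply: LinSpan0.
rewrite mulrDl -scalerAl; apply: lin_spanD => //; apply: lin_spanZ.
elim: spP' => [|d F' H' SF' _ IH']; first by rewrite mulr0; apply: LinSpan0.
rewrite mulrDr -scalerAr; apply: lin_spanD => //; apply: lin_spanZ.
exact/lin_span_in/lead_mul_closed.
Qed.

(** Lead monomials of [A] multiply to lead monomials of [A], so their span is already an algebra and
    contains what the generators' lead monomials generate. Conversely, [A_lead] writes each lead
    monomial of [A] as a product of those of the generators. *)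
Lemma sagbi_basis : is_sagbi_basis A b.
Proof.
split=> [F /tnthP[i ->] //|P]; split.
  elim=> {P} [P [F [m [FB lead_F ->]]]|c|P P' _ IH _ IH'|P P' _ IH _ IH'].
  - apply: lin_span_in; exists F, m; split=> //.
    by case/tnthP: FB => i ->.
  - rewrite -[c]mulr1 mpolyCM mul_mpolyC mpolyC1; apply/lin_spanZ/lin_span_in.
    by exists 1, 0%MM; rewrite mpolyX0 -{1}mpolyC1; split=> //; apply: is_lead1.
  - exact: lin_spanD.
  - exact: lin_spanM.
elim=> {P} [|c P H [F [m [AF /(A_lead _ _ AF)[I ->] ->]]] _ IH].
  by rewrite -mpolyC0; apply: AlgGenC.
apply: AlgGenD => //; rewrite -mul_mpolyC; apply: AlgGenM; first exact: AlgGenC.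
have gen1 S : alg_gen S (1 : {mpoly K[n]}) by rewrite -mpolyC1; apply: AlgGenC.
rewrite /lead_exp; elim/big_rec: _ => [|i m' _ IHm]; first by rewrite mpolyX0.
rewrite mpolyXD -mpolyXn; apply: AlgGenM => //.
elim: (I i) => [|k IHk]; rewrite ?expr0 // exprS; apply: AlgGenM => //.
by apply: AlgGenIn; exists (tnth b i), (l i); split=> //; apply: mem_tnth.
Qed.

(** By [A_lead] some product has the lead monomial of [F]. Subtracting its multiple stays in [A] and
    moves the whole support below that monomial, so a strict bound on the ranks in the support
    decreases at every step. *)
Lemma subducts_to0 F : A F -> exists T, subducts b F T 0.
Proof.
suff IH N : A F -> {in msupp F, forall m, grevlex_rank m < N}%N ->
    exists T, subducts b F T 0.
  move=> AF; apply: (IH (\max_(m <- msupp F) (grevlex_rank m).+1)%N) => // m mF.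
  exact: (leq_bigmax_seq m).
elim: N F => [|N IH] F AF rkF; have [F0|/is_lead_exists[m lead_F]] := eqVneq F 0;
    try by exists 0; rewrite F0; apply: SubductsRefl.
  by case: lead_F => /rkF.
have [I mE] := A_lead _ _ AF lead_F; have lead_I := lead_exp_monomial I.
rewrite -mE in lead_I; have /is_lead_suppP[Fm le_F] := lead_F.
have [c lt_FI FmE] := supp_lt_reduce _ _ _ le_F lead_I.
have [||T sub_T] := IH (F - c *: ('X_[I] \mPo b)).
- rewrite -scaleNr -mul_mpolyC; apply: AD => //; apply: AM => //.
  exact: subalgebra_comp.
- move=> m' /lt_FI/grevlex_rank_lt lt_m'; apply: leq_trans lt_m' _.
  by have := rkF m; rewrite ltnS; apply; case: lead_F.
exists (c *: 'X_[I] + T); apply: SubductsStep sub_T; exists m; split=> //.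
apply: is_leadZ => //; apply: contraNneq Fm => c0.
by rewrite FmE c0 scale0r mcoeff0.
Qed.

End Subalgebra.

(** * Relation ideals generated by a polynomial monic in one variable *)

Section Relations.
Variables (v : 'I_r) (k : nat).

Definition low_degree Q := {in msupp Q, forall I, I v < k}%N.

Lemma low_degreeD Q Q' : low_degree Q -> low_degree Q' -> low_degree (Q + Q').
Proof.
by move=> lowQ lowQ' I /msuppD_le; rewrite mem_cat => /orP[/lowQ|/lowQ'].
Qed.

Lemma low_degreeZ c Q : low_degree Q -> low_degree (c *: Q).
Proof. by move=> lowQ I /msuppZ_le/lowQ. Qed.

Lemma low_degreeMX Q (J : 'X_{1..r}) :
  J v = 0%N -> low_degree Q -> low_degree (Q * 'X_[J]).
Proof.
move=> Jv lowQ I; rewrite (perm_mem (msuppMX _ _)) => /mapP[I' /lowQ lowI' ->].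
by rewrite mnmDE Jv add0n.
Qed.

(** As in division by a monic polynomial in the variable [v], a monomial with exponent at least [k]
    is rewritten by replacing ['X_v ^+ k] with [- c^-1 *: L], which lowers its exponent of [v]. *)
Lemma low_degree_division (c : K) (L : {mpoly K[r]}) : c != 0 ->
  low_degree L -> forall Q, exists S Q',
  Q = S * (c *: 'X_v ^+ k + L) + Q' /\ low_degree Q'.
Proof.
move=> c0 lowL; set R := _ + L.
pose red Q := exists S Q', Q = S * R + Q' /\ low_degree Q'.
have low0 : low_degree 0 by move=> I; rewrite msupp0.
have red0 : red 0 by exists 0, 0; rewrite mul0r addr0.
have redD Q Q' : red Q -> red Q' -> red (Q + Q').
  move=> [S [T [-> lowT]]] [S' [T' [-> lowT']]]; exists (S + S'), (T + T').
  by rewrite mulrDl addrACA; split=> //; apply: low_degreeD.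
have redZ a Q : red Q -> red (a *: Q).
  move=> [S [T [-> lowT]]]; exists (a *: S), (a *: T).
  by rewrite scalerDr scalerAl; split=> //; apply: low_degreeZ.
have redX d I : (I v < d)%N -> red 'X_[I].
  elim: d I => // d IH I; rewrite ltnS => le_Id.
  have [lt_Ik|le_kI] := ltnP (I v) k.
    exists 0, 'X_[I]; rewrite mul0r add0r; split=> // J.
    by rewrite msuppX inE => /eqP->.
  set J := (I - U_(v) *+ k)%MM; have IE : I = (J + U_(v) *+ k)%MM.
    rewrite /J submK //; apply/mnm_lepP => i; rewrite mulmnE mnm1E.
    by case: eqVneq => [<-|]; rewrite ?mul1n.
  have Jv : (J v + k = I v)%N by rewrite [in RHS]IE mnmDE mulmnE mnm1E eqxx mul1n.
  have -> : 'X_[I] = (c^-1 *: 'X_[J]) * R + - c^-1 *: (L * 'X_[J]).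
    rewrite /R mulrDr -scalerAl -scalerAr scalerA mulVf // scale1r.
    rewrite {1}IE mpolyXD mpolyXn -addrA -scalerAl (mulrC L) scaleNr subrr.
    by rewrite addr0.
  apply: (redD); first by exists (c^-1 *: 'X_[J]), 0; rewrite addr0.
  apply: (redZ); rewrite [L]mpolyE mulr_suml big_seq.
  apply: (big_ind red red0 redD) => I' /lowL lt_I'k.
  rewrite -scalerAl -mpolyXD; apply/redZ/IH; rewrite mnmDE; lia.
by elim/mpolyind => // a I Q _ _ redQ; apply/redD/redQ/redZ/(redX (I v).+1).
Qed.

(** The remainder of a relation is again a relation. Its products have distinct lead monomials, so a
    nonzero remainder would take a nonzero value. *)
Lemma generates_relations_of_monic (c : K) (L : {mpoly K[r]}) :
  (forall I J : 'X_{1..r}, (I v < k)%N -> (J v < k)%N ->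
     lead_exp I = lead_exp J -> I = J) ->
  c != 0 -> low_degree L -> (c *: 'X_v ^+ k + L) \mPo b = 0 ->
  generates_relations b (c *: 'X_v ^+ k + L).
Proof.
move=> inj_exp c0 lowL Rb Q; split=> [Qb|[S ->]]; last first.
  by rewrite rmorphM /= Rb mulr0.
have [S [Q' [QE lowQ']]] := low_degree_division c L c0 lowL Q.
exists S; rewrite QE; have [->|Q'0] := eqVneq Q' 0; first by rewrite addr0.
have [I J IQ' JQ'|I _ /is_lead_neq0] := lead_exp_comb Q' _ Q'0.
  by apply: inj_exp; apply: lowQ'.
by move: Qb; rewrite QE rmorphD rmorphM /= Rb mulr0 add0r => ->; rewrite eqxx.
Qed.

End Relations.

End Subduction.

(** * Minors of Gamma *)

Lemma gamE (K : fieldType) (p : nat) (X : 'M[K]_2) (i j : 'I_4) :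
  gam p X i j = Gam p X i 0 * Gam p X j 1 - Gam p X i 1 * Gam p X j 0.
Proof.
rewrite /gam; move: (Gam p X) => G.
rewrite (expand_det_row _ 0) !big_ord_recl big_ord0 /cofactor !det_mx11.
rewrite !mxE /= expr0 expr1 mul1r addr0 mulN1r mulrN.
by congr (_ * G j _ - G i _ * G j _); apply: val_inj.
Qed.

Lemma Gam_up (K : fieldType) (p : nat) (X : 'M[K]_2) (i : 'I_4) (k j : 'I_2) :
  i = k :> nat -> Gam p X i j = X k j.
Proof.
move=> ik; rewrite mxE; case: splitP => k' k'E; last first.
  by move: (ltn_ord k); rewrite -ik k'E ltnNge leq_addr.
by congr (X _ j); apply: val_inj; rewrite /= -k'E.
Qed.

Lemma Gam_down (K : fieldType) (p : nat) (X : 'M[K]_2) (i : 'I_4) (k j : 'I_2) :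
  i = (2 + k)%N :> nat -> Gam p X i j = X k j ^+ p.
Proof.
move=> ik; rewrite mxE; case: splitP => k' k'E; first by move: (ltn_ord k'); rewrite -k'E ik ltnNge leq_addr.
rewrite mxE; congr (X _ j ^+ p); apply: val_inj.
by apply/eqP; rewrite -(eqn_add2l 2) -k'E ik.
Qed.

Lemma gam01E (K : fieldType) (p : nat) (X : 'M[K]_2) :
  gam p X 0 1 = X 0 0 * X 1 1 - X 0 1 * X 1 0.
Proof. by rewrite gamE !(Gam_up _ _ _ 0 0) // !(Gam_up _ _ _ 1 1). Qed.

Lemma gam02E (K : fieldType) (p : nat) (X : 'M[K]_2) :
  gam p X 0 2 = X 0 0 * X 0 1 ^+ p - X 0 1 * X 0 0 ^+ p.
Proof. by rewrite gamE !(Gam_up _ _ _ 0 0) // !(Gam_down _ _ _ 2 0). Qed.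

Lemma ord2_cases (i : 'I_2) : i = 0 \/ i = 1.
Proof. by case: i => -[|[|//]] h; [left | right]; apply: val_inj. Qed.

(** Cramer's linear relation among rows 1, 2, 3 of Gamma, three vectors in a plane, whose
    coefficients are their minors. *)
Lemma gam_plucker0 (K : fieldType) (p : nat) (X : 'M[K]_2) (i : 'I_2) :
  gam p X 0 1 * X 0 i ^+ p + gam p X 1 2 * X 0 i = gam p X 0 2 * X 1 i.
Proof.
rewrite !gamE !(Gam_up _ _ _ 0 0) // !(Gam_up _ _ _ 1 1) //.
rewrite !(Gam_down _ _ _ 2 0) //.
by case: (ord2_cases i) => ->; ring.
Qed.

(** The same relation for rows 1, 2, 4. *)
Lemma gam_plucker1 (K : fieldType) (p : nat) (X : 'M[K]_2) (i : 'I_2) :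
  gam p X 0 1 * X 1 i ^+ p + gam p X 1 3 * X 0 i = gam p X 0 3 * X 1 i.
Proof.
rewrite !gamE !(Gam_up _ _ _ 0 0) // !(Gam_up _ _ _ 1 1) //.
rewrite !(Gam_down _ _ _ 3 1) //.
by case: (ord2_cases i) => ->; ring.
Qed.

(** * The invariants in the chart *)

Lemma mpoly_morph_eq (K : fieldType) (n : nat) (S : comNzRingType)
    (f g : {rmorphism {mpoly K[n]} -> S}) :
  (forall c, f c%:MP = g c%:MP) -> (forall i, f 'X_i = g 'X_i) -> f =1 g.
Proof.
move=> fgC fgX F; rewrite [F]mpolyE !rmorph_sum /=; apply: eq_bigr => m _.
rewrite -mul_mpolyC mpolyXE_id !rmorphM fgC /=; congr (_ * _).
by rewrite !rmorph_prod /=; apply: eq_bigr => i _; rewrite !rmorphXn /= fgX.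
Qed.

Lemma ord3_cases (i : 'I_3) : [\/ i = 0, i = 1 | i = 2].
Proof.
case: i => -[|[|[|//]]] h; [apply: Or31|apply: Or32|apply: Or33];
  exact: val_inj.
Qed.

Section Chart.
Context {K : fieldType} {p : nat} {X : 'M[K]_2}.
Hypothesis p_gt2 : (2 < p)%N.
Hypothesis g13_neq0 : gam p X 0 2 != 0.

Notation D := {mpoly K[2]}.
Notation g12 := (gam p X 0 1).
Notation g13 := (gam p X 0 2).
Notation g23 := (gam p X 1 2).
Notation g14 := (gam p X 0 3).
Notation g24 := (gam p X 1 3).

(** The chart ring [{poly D}] is K[x, u][Y]: the coefficient ring [D] holds the constants, [x] and
    [u], and ['X] is the coordinate Y. *)
Definition cst (c : K) : {poly D} := c%:MP%:P.
HB.instance Definition _ := GRing.RMorphism.copy cst (polyC \o @mpolyC 2 K).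

Definition xD : {poly D} := ('X_0)%:P.
Definition uD : {poly D} := ('X_1)%:P.

(** On x = 1 the equation u = f_1 reads u = gamma_12 Y^p + gamma_13 delta + gamma_23 Y. It is linear
    in delta, and this is its solution; [zetaD] then comes from delta = Y^2 - z. *)
Definition deltaD : {poly D} :=
  cst g13^-1 * (uD - cst g12 * 'X ^+ p - cst g23 * 'X).

Definition zetaD : {poly D} := 'X ^+ 2 - deltaD.

(* The chart y = x Y, z = x zeta; on x = 1 it trades the coordinate z for
   u = f_1, so that the group only translates Y. *)
Definition chart_tuple : 3.-tuple {poly D} :=
  [tuple xD; xD * 'X; xD * zetaD].

Definition chart : {mpoly K[3]} -> {poly D} := mmap cst (tnth chart_tuple).
HB.instance Definition _ :=
  GRing.RMorphism.copy chart (mmap cst (tnth chart_tuple)).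

Lemma chartC c : chart c%:MP = cst c.
Proof. exact: mmapC. Qed.

Lemma chartZ c F : chart (c *: F) = cst c * chart F.
Proof. exact: mmapZ. Qed.

Lemma chart_var i : chart 'X_i = tnth chart_tuple i.
Proof. by rewrite /chart mmapX mmap1U. Qed.

Lemma chart_x : chart xV = xD. Proof. exact: chart_var. Qed.
Lemma chart_y : chart yV = xD * 'X. Proof. exact: chart_var. Qed.
Lemma chart_z : chart zV = xD * zetaD. Proof. exact: chart_var. Qed.

Lemma xD_neq0 : xD != 0.
Proof. by rewrite polyC_eq0 -msize_poly_eq0 msizeX. Qed.

Lemma chart_delta : chart delta = xD ^+ 2 * deltaD.
Proof.
rewrite /delta rmorphB rmorphXn rmorphM /= chart_x chart_y chart_z /zetaD; ring.
Qed.

Lemma cst_neq0 c : c != 0 -> cst c != 0.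
Proof. by rewrite polyC_eq0 mpolyC_eq0. Qed.

Lemma cstV c : c != 0 -> cst c^-1 * cst c = 1.
Proof. by move=> c0; rewrite -rmorphM /= mulVf ?rmorph1. Qed.

Lemma deltaD_def : cst g13 * deltaD = uD - cst g12 * 'X ^+ p - cst g23 * 'X.
Proof. by rewrite mulrA [cst _ * _]mulrC cstV // mul1r. Qed.

Lemma chart_f1 : chart (f1 p X) = xD ^+ p * uD.
Proof.
have uE : uD = cst g12 * 'X ^+ p + cst g13 * deltaD + cst g23 * 'X.
  by rewrite deltaD_def; ring.
rewrite /f1 !rmorphD /= !chartZ !(rmorphXn, rmorphM) /= chart_delta chart_x chart_y.
rewrite uE.
have [q ->] : exists q, p = q.+2 by exists (p - 2)%N; lia.
have -> : (q.+2 - 2 = q)%N by lia.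
have -> : (q.+2 - 1 = q.+1)%N by lia.
by rewrite exprMn !exprS; ring.
Qed.

Definition f124D : {poly D} :=
  - (cst g12 * deltaD ^+ p) + cst g14 * deltaD + cst g24 * 'X.

Lemma chart_f124 : chart (f124 p X) = xD ^+ (2 * p) * f124D.
Proof.
rewrite /f124 !rmorphD rmorphN /= !chartZ !(rmorphXn, rmorphM) /= chart_delta.
rewrite chart_x chart_y /f124D.
have -> : (2 * p - 1 = (2 * p - 2) + 1)%N by lia.
have {3}-> : (2 * p = (2 * p - 2) + 2)%N by lia.
have -> : (xD ^+ 2 * deltaD) ^+ p = xD ^+ (2 * p - 2 + 2) * deltaD ^+ p.
  rewrite exprMn -exprM; congr (_ ^+ _ * _); lia.
rewrite !exprD; ring.
Qed.

(* Back from the chart by x = x, Y = y, u = f_1(1, y, z). *)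
Definition unchart_tuple : 2.-tuple {mpoly K[3]} :=
  [tuple xV; g12 *: yV ^+ p + g13 *: (yV ^+ 2 - zV) + g23 *: yV].

Definition blowup : 3.-tuple {mpoly K[3]} := [tuple xV; xV * yV; xV * zV].

Lemma unchart_exists : exists un : {rmorphism {poly D} -> {mpoly K[3]}},
  [/\ forall c, un (cst c) = c%:MP, un xD = xV, un 'X = yV
    & un uD = g12 *: yV ^+ p + g13 *: (yV ^+ 2 - zV) + g23 *: yV].
Proof.
exists (horner_eval (yV : {mpoly K[3]}) \o
  map_poly (comp_mpoly unchart_tuple)).
split=> [c|||] /=; rewrite /horner_eval ?map_polyX ?hornerX //.
- by rewrite map_polyC hornerC /= comp_mpolyC.
- by rewrite map_polyC hornerC /= comp_mpolyXU.
- by rewrite map_polyC hornerC /= comp_mpolyXU.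
Qed.

(** Undoing the exchange of z for u leaves the substitution y -> xy, z -> xz, because y/x and z/x
    are not polynomials. This still suffices for the injectivity of [chart]. *)
Lemma unchartK : exists un : {poly D} -> {mpoly K[3]},
  forall F, un (chart F) = F \mPo blowup.
Proof.
have [un [unC un_x un_Y un_u]] := unchart_exists.
have un_delta : un deltaD = yV ^+ 2 - zV.
  rewrite rmorphM unC !rmorphB !rmorphM rmorphXn !unC un_u un_Y -!mul_mpolyC.
  have -> : forall b c d e g : {mpoly K[3]},
    b * (c * d + g13%:MP * e + g * yV - c * d - g * yV) =
    (b * g13%:MP) * e by move=> *; ring.
  by rewrite -mpolyCM mulVf // mpolyC1 mul1r.
have un_zeta : un zetaD = zV by rewrite rmorphB rmorphXn un_Y un_delta; ring.
exists un => F.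
apply: (mpoly_morph_eq _ _ _ (un \o chart) (comp_mpoly blowup)) => [c|i] /=.
  by rewrite chartC unC comp_mpolyC.
rewrite chart_var comp_mpolyXU.
case: (ord3_cases i) => ->; rewrite !(tnth_nth 0) //=; rewrite ?rmorphM /=;
  by rewrite un_x ?un_Y ?un_zeta.
Qed.

(** The substitution maps monomials injectively to monomials, adding the exponents of y and z to
    that of x, so every coefficient can be read back. *)
Lemma comp_blowup_inj : injective (comp_mpoly blowup).
Proof.
pose sh (m : 'X_{1..3}) : 'X_{1..3} := (m + U_(0%R) *+ (m 1%R + m 2%R))%MM.
have shE m i : sh m i = (m i + (i == 0%R) * (m 1%R + m 2%R))%N.
  by rewrite mnmDE mulmnE mnm1E eq_sym.
have sh_inj : injective sh.
  move=> m m' /mnmP mm'; have m1 := mm' 1; have m2 := mm' 2.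
  have m0 := mm' 0; rewrite !shE /= in m0 m1 m2.
  by apply/mnmP => i; case: (ord3_cases i) => ->; lia.
have compE m : 'X_[m] \mPo blowup = 'X_[sh m].
  rewrite comp_mpolyX !big_ord_recl big_ord0 !(tnth_nth 0) /= /sh mpolyXD.
  rewrite [in RHS]mpolyXE_id !big_ord_recl big_ord0 -mpolyXn.
  have -> : lift ord0 ord0 = 1 :> 'I_3 by apply: val_inj.
  have -> : lift ord0 (lift ord0 ord0) = 2 :> 'I_3 by apply: val_inj.
  by rewrite !exprMn exprD /xV /yV /zV; ring.
move=> F F' FF'; apply/mpolyP => m.
have coeffE (E : {mpoly K[3]}) : (E \mPo blowup)@_(sh m) = E@_m.
  rewrite comp_mpolyEX raddf_sum /= [in RHS](mpolyE E) raddf_sum /=; apply: eq_bigr => m' _.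
  by rewrite !mcoeffZ compE !mcoeffX (inj_eq sh_inj).
by rewrite -!coeffE FF'.
Qed.

Lemma chart_inj : injective chart.
Proof.
have [un unE] := unchartK.
by move=> F F' FF'; apply: comp_blowup_inj; rewrite -!unE FF'.
Qed.

(** * The group acting by translations of Y *)

Hypothesis pK : p \in [pchar K].

Let p_pr : prime p := pcharf_prime pK.
Let p_gt0 : (0 < p)%N := prime_gt0 p_pr.

Definition translate (c : K) (W : {poly D}) : {poly D} := W \Po ('X + cst c).
HB.instance Definition _ c :=
  GRing.RMorphism.copy (translate c) (comp_poly ('X + cst c)).

Lemma translate_cst c e : translate c (cst e) = cst e.
Proof. exact: comp_polyC. Qed.

Lemma translate_polyC c (q : D) : translate c q%:P = q%:P.
Proof. exact: comp_polyC. Qed.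

Lemma translate_Y c : translate c 'X = 'X + cst c.
Proof. exact: comp_polyX. Qed.

Lemma translateD c e W : translate e (translate c W) = translate (c + e) W.
Proof.
have ce : cst c \Po ('X + cst e) = cst c := comp_polyC _ _.
rewrite -[LHS]comp_polyA comp_polyD comp_polyX ce -addrA.
by rewrite -rmorphD /= [e + c]addrC.
Qed.

Lemma translate0 W : translate 0 W = W.
Proof. by rewrite /translate rmorph0 addr0 comp_polyXr. Qed.

#[local] Opaque chart translate.

Lemma translate_iter c k W : translate c W = W -> translate (c *+ k) W = W.
Proof.
move=> cW; elim: k => [|k IH]; first by rewrite mulr0n translate0.
by rewrite mulrS -translateD cW.
Qed.

Lemma frobenius_polyD (V W : {poly D}) : (V + W) ^+ p = V ^+ p + W ^+ p.
Proof.
have pV : p \in [pchar {poly D}] := rmorph_pchar cst pK.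
exact: (rmorphD (pFrobenius_aut pV)).
Qed.

(** With u fixed and Frobenius additive, [deltaD] changes only by a constant, which [gam_plucker0]
    identifies with the entry of the second row. This is what makes the image of z agree with the
    group action. *)
Lemma translate_delta i :
  translate (X 0 i) deltaD = deltaD - cst (X 1 i).
Proof.
rewrite /deltaD rmorphM !rmorphB !rmorphM rmorphXn /= !translate_cst.
rewrite translate_Y translate_polyC frobenius_polyD -/uD.
have -> : cst (X 1 i) =
    cst g13^-1 * (cst g12 * cst (X 0 i) ^+ p + cst g23 * cst (X 0 i)).
  rewrite -rmorphXn -!rmorphM -rmorphD -rmorphM /=; congr cst.
  by rewrite gam_plucker0 mulrA mulVf // mul1r.
ring.
Qed.

HB.instance Definition _ i := GRing.RMorphism.copy (act_gen X i)
  (comp_mpoly [tuple xV; yV + X 0 i *: xV;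
     zV + (2 * X 0 i) *: yV + (X 0 i ^+ 2 + X 1 i) *: xV]).

Lemma act_gen_x i : act_gen X i xV = xV.
Proof. exact: comp_mpolyXU. Qed.

Lemma act_gen_y i : act_gen X i yV = yV + X 0 i *: xV.
Proof. exact: comp_mpolyXU. Qed.

Lemma act_gen_z i :
  act_gen X i zV = zV + (2 * X 0 i) *: yV + (X 0 i ^+ 2 + X 1 i) *: xV.
Proof. exact: comp_mpolyXU. Qed.

Lemma act_genZ i c F : act_gen X i (c *: F) = c *: act_gen X i F.
Proof. exact: comp_mpolyZ. Qed.

Lemma chart_act_gen i F : chart (act_gen X i F) = translate (X 0 i) (chart F).
Proof.
apply: (mpoly_morph_eq _ _ _ (chart \o act_gen X i)
  (translate (X 0 i) \o chart)) => [c|j] /=.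
  by rewrite /act_gen comp_mpolyC chartC translate_cst.
have tx : translate (X 0 i) xD = xD := translate_polyC _ _.
case: (ord3_cases j) => ->.
- by rewrite -/xV act_gen_x chart_x tx.
- rewrite -/yV act_gen_y rmorphD /= chartZ chart_x chart_y rmorphM /= tx.
  by rewrite translate_Y; ring.
rewrite -/zV act_gen_z !rmorphD /= !chartZ chart_x chart_y chart_z.
rewrite [translate _ _]rmorphM /= tx.
rewrite /zetaD rmorphB rmorphXn /= translate_Y translate_delta rmorphD rmorphM.
rewrite rmorphXn rmorph_nat /=; ring.
Qed.

Definition shift (g : 'Z_p * 'Z_p) : K := X 0 0 *+ g.1 + X 0 1 *+ g.2.

Lemma chart_act g F : chart (act X F g) = translate (shift g) (chart F).
Proof.
have chart_iter i k E :
    chart (iter k (act_gen X i) E) = translate (X 0 i *+ k) (chart E).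
  elim: k => [|k IH]; first by rewrite mulr0n translate0.
  rewrite iterS chart_act_gen IH translateD mulrSr; reflexivity.
rewrite /act !chart_iter translateD; reflexivity.
Qed.

Definition invariantD (W : {poly D}) : Prop :=
  forall g, translate (shift g) W = W.

Lemma G_invariantP F : G_invariant p X F <-> invariantD (chart F).
Proof.
split=> [invF g|invF g]; first by rewrite -chart_act invF.
by apply: chart_inj; rewrite chart_act invF.
Qed.

Lemma invariantD_gen W : (forall i, translate (X 0 i) W = W) -> invariantD W.
Proof.
by move=> gW g; rewrite -translateD !translate_iter.
Qed.

Lemma invariantD_mull W V : W != 0 -> invariantD W ->
  invariantD (W * V) -> invariantD V.
Proof.
move=> W0 invW invWV g; apply: (mulfI W0).
by rewrite -[RHS](invWV g) rmorphM /= invW.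
Qed.

Lemma invariantDD W V : invariantD W -> invariantD V -> invariantD (W + V).
Proof. by move=> invW invV g; rewrite rmorphD /= invW invV. Qed.

Lemma invariantDM W V : invariantD W -> invariantD V -> invariantD (W * V).
Proof. by move=> invW invV g; rewrite rmorphM /= invW invV. Qed.

Lemma invariantDX W k : invariantD W -> invariantD (W ^+ k).
Proof. by move=> invW g; rewrite rmorphXn /= invW. Qed.

Lemma invariantD_polyC (q : D) : invariantD q%:P.
Proof. by move=> g; apply: translate_polyC. Qed.

(** The coefficient of y alone will separate the elements of the orbit, so that of x is left
    unspecified. *)
Lemma act_z g : exists e, act X zV g = zV + (2 * shift g) *: yV + e *: xV.
Proof.
have step i k c e : exists e',
    iter k (act_gen X i) (zV + (2 * c) *: yV + e *: xV)
    = zV + (2 * (c + X 0 i *+ k)) *: yV + e' *: xV.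
  elim: k => [|k [e' IH]]; first by exists e; rewrite mulr0n addr0.
  exists ((X 0 i ^+ 2 + X 1 i) + 2 * (c + X 0 i *+ k) * X 0 i + e').
  rewrite iterS IH !rmorphD /= !act_genZ act_gen_x act_gen_y act_gen_z mulrSr.
  rewrite -!mul_mpolyC !(rmorphXn, rmorph_nat, rmorphD, rmorphM) /=; ring.
have zE : zV = zV + (2 * 0) *: yV + 0 *: xV :> {mpoly K[3]}.
  by rewrite mulr0 !scale0r !addr0.
have [e1 E1] := step 0 g.1 0 0; have [e2 E2] := step 1 g.2 (0 + X 0 0 *+ g.1) e1.
by exists e2; rewrite /act [X in iter _ _ (iter _ _ X)]zE E1 E2 add0r.
Qed.

Lemma natr_inj_mod (a b : nat) : (a < p)%N -> (b < p)%N ->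
  a%:R = b%:R :> K -> a = b.
Proof.
wlog le_ab : a b / (a <= b)%N => [IH|] lt_ap lt_bp abE.
  by case: (leqP a b) => [/IH|/ltnW/IH h]; [apply | apply/esym/h].
have /eqP : (b - a)%:R = 0 :> K by rewrite natrB // abE subrr.
rewrite -(dvdn_pcharf pK) => dvd_p; have [|lt_ab] := leqP b a.
  by move=> le_ba; apply/eqP; rewrite eqn_leq le_ab.
have := dvdn_leq _ dvd_p; rewrite subn_gt0 => /(_ lt_ab).
by rewrite leqNgt (leq_ltn_trans (leq_subr _ _) lt_bp).
Qed.

Lemma ltn_Zp (a : 'Z_p) : (a < p)%N.
Proof. by have := ltn_ord a; rewrite [X in (_ < X)%N]Zp_cast // prime_gt1. Qed.

(** A coincidence gives x_11 s + x_12 t = 0 with s and t in the prime field. Since Frobenius fixes s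
    and t, the p-th power gives x_11^p s + x_12^p t = 0; the determinant of the two equations is
    gamma_13, so s = t = 0. *)
Lemma shift_inj : injective shift.
Proof.
move=> [g1 g2] [h1 h2]; rewrite /shift /= => gh.
pose s : K := g1%:R - h1%:R; pose t : K := g2%:R - h2%:R.
have frob (a b : nat) : (a%:R - b%:R : K) ^+ p = a%:R - b%:R.
  rewrite -!(pFrobenius_autE pK) rmorphB /= !rmorph_nat //.
have st : X 0 0 * s + X 0 1 * t = 0.
  rewrite !mulrBr !mulr_natr addrACA gh -opprD subrr //.
have stp : X 0 0 ^+ p * s + X 0 1 ^+ p * t = 0.
  have sp : s ^+ p = s := frob g1 h1; have tp : t ^+ p = t := frob g2 h2.
  rewrite -sp -tp -!exprMn -!(pFrobenius_autE pK).
  by rewrite -rmorphD st rmorph0.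
have s0 : s = 0.
  apply: (mulIf g13_neq0); rewrite gam02E mul0r.
  have -> : s * (X 0 0 * X 0 1 ^+ p - X 0 1 * X 0 0 ^+ p) =
    (X 0 0 * s + X 0 1 * t) * X 0 1 ^+ p
    - X 0 1 * (X 0 0 ^+ p * s + X 0 1 ^+ p * t) by ring.
  by rewrite st stp mul0r mulr0 subr0.
have t0 : t = 0.
  apply: (mulIf g13_neq0); rewrite gam02E mul0r.
  have -> : t * (X 0 0 * X 0 1 ^+ p - X 0 1 * X 0 0 ^+ p) =
    X 0 0 * (X 0 0 ^+ p * s + X 0 1 ^+ p * t)
    - (X 0 0 * s + X 0 1 * t) * X 0 0 ^+ p by ring.
  by rewrite st stp mul0r mulr0 subr0.
congr (_, _); apply/val_inj/natr_inj_mod; rewrite ?ltn_Zp //.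
  by apply/eqP; rewrite -subr_eq0 -/s s0.
by apply/eqP; rewrite -subr_eq0 -/t t0.
Qed.

(** * The orbit product of z, and f_2, in the chart *)

Lemma two_neq0 : (2 : K) != 0.
Proof.
rewrite -(dvdn_pcharf pK); apply/negP => /(dvdn_leq (isT : (0 < 2)%N)).
by rewrite leqNgt p_gt2.
Qed.

(** The stabilizer of z is trivial: the coefficients [2 * shift g] of y are pairwise distinct
    because p is odd. Hence [undup] removes nothing. *)
Lemma NGzE : NGz p X = \prod_(g : 'Z_p * 'Z_p) act X zV g.
Proof.
have act_inj : injective (act X zV : 'Z_p * 'Z_p -> _).
  move=> g h; have [e ->] := act_z g; have [e' ->] := act_z h.
  move=> /(congr1 (mcoeff U_(1))); rewrite !mcoeffD !mcoeffZ !mcoeffXU /=.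
  rewrite !mulr1 !mulr0 !addr0 !add0r => /(mulfI two_neq0); exact: shift_inj.
rewrite /NGz undup_id; first by rewrite big_image.
by rewrite map_inj_uniq // enum_uniq.
Qed.

Definition ND : {poly D} := \prod_(g : 'Z_p * 'Z_p) translate (shift g) zetaD.

Lemma card_Zp2 : #|{: 'Z_p * 'Z_p}| = (p ^ 2)%N.
Proof. by rewrite card_prod !card_ord !Zp_cast ?prime_gt1 // mulnn. Qed.

Lemma chart_N : chart (NGz p X) = xD ^+ (p ^ 2) * ND.
Proof.
rewrite NGzE rmorph_prod /ND -card_Zp2 -prodr_const -big_split /=.
apply: eq_bigr => g _; rewrite chart_act chart_z rmorphM /=.
by rewrite translate_polyC.
Qed.

Lemma NGz_invariant : G_invariant p X (NGz p X).
Proof.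
move=> h; apply: chart_inj; rewrite chart_act NGzE !rmorph_prod /=.
rewrite [RHS](reindex_inj (addIr h)) /=; apply: eq_bigr => g _.
by rewrite actD // [in RHS]chart_act.
Qed.

Lemma frobenius_polyB (V W : {poly D}) : (V - W) ^+ p = V ^+ p - W ^+ p.
Proof.
have pV : p \in [pchar {poly D}] := rmorph_pchar cst pK.
exact: (rmorphB (pFrobenius_aut pV)).
Qed.

Definition f2D : {poly D} := cst 2^-1 * (cst g12 * f124D + uD ^+ 2).

(** Checked after multiplication by 2 x^(p-2), where gamma_12 f_124 and f_1^2 both carry the factor
    x^(2p). *)
Lemma chart_f2 : chart (f2 p X) = xD ^+ (p + 2) * f2D.
Proof.
have x0 : cst 2 * xD ^+ (p - 2) != 0.
  apply: mulf_neq0; first exact/cst_neq0/two_neq0.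
  exact/expf_neq0/xD_neq0.
apply: (mulfI x0); move: (f2_exact X pK p_gt2); move: (f2 p X) => F.
move/(congr1 chart).
rewrite rmorphD /= !chartZ rmorphM !rmorphXn /= chart_x chart_f124 chart_f1.
rewrite mulrA => ->.
have -> : cst 2 * xD ^+ (p - 2) * (xD ^+ (p + 2) * f2D) =
    (cst 2^-1 * cst 2) * (xD ^+ (p - 2) * xD ^+ (p + 2)) *
    (cst g12 * f124D + uD ^+ 2) by rewrite /f2D; ring.
rewrite cstV ?two_neq0 // mul1r -exprD.
have -> : (p - 2 + (p + 2) = 2 * p)%N by lia.
rewrite exprMn -exprM [(p * 2)%N]mulnC; ring.
Qed.

(** The changes of delta^p, delta and Y are constants, and [gam_plucker1] says that their
    combination vanishes. *)
Lemma translate_f124 i : translate (X 0 i) f124D = f124D.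
Proof.
rewrite /f124D; move: deltaD (translate_delta i) => d dE.
rewrite !rmorphD rmorphN !rmorphM rmorphXn /= !translate_cst.
rewrite translate_Y dE frobenius_polyB.
have := congr1 cst (gam_plucker1 K p X i).
rewrite rmorphD !rmorphM rmorphXn /= => E.
have -> : forall P : {poly D}, - (cst g12 * (P - cst (X 1 i) ^+ p))
    + cst g14 * (d - cst (X 1 i)) + cst g24 * ('X + cst (X 0 i)) =
    - (cst g12 * P) + cst g14 * d + cst g24 * 'X +
    (cst g12 * cst (X 1 i) ^+ p + cst g24 * cst (X 0 i)
      - cst g14 * cst (X 1 i)) by move=> P; ring.
by rewrite E subrr addr0.
Qed.

Lemma f2D_invariant : invariantD f2D.
Proof.
apply: invariantD_gen => i; rewrite /f2D; move: f124D (translate_f124 i) => W WE.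
rewrite rmorphM rmorphD rmorphM rmorphXn /= !translate_cst WE.
by rewrite translate_polyC.
Qed.

Lemma f1_invariant : G_invariant p X (f1 p X).
Proof.
apply/G_invariantP; rewrite chart_f1; apply: invariantDM.
  exact/invariantDX/invariantD_polyC.
exact: invariantD_polyC.
Qed.

Lemma f2_invariant : G_invariant p X (f2 p X).
Proof.
apply/G_invariantP; rewrite chart_f2; apply: invariantDM.
  exact/invariantDX/invariantD_polyC.
exact: f2D_invariant.
Qed.

Lemma ND_invariant : invariantD ND.
Proof.
apply: (invariantD_mull (xD ^+ (p ^ 2))).
- exact/expf_neq0/xD_neq0.
- exact/invariantDX/invariantD_polyC.
by rewrite -chart_N; apply/G_invariantP/NGz_invariant.
Qed.

(** * Invariants of small degree, and degrees in Y *)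

Lemma small_invariantD q :
  invariantD q -> (size q <= p ^ 2)%N -> q = (q.[0])%:P.
Proof.
move=> invq szq; apply/eqP; rewrite -subr_eq0; apply: contraTT szq => r0.
rewrite -ltnNge; set r := q - _ in r0.
have sz_r : (size r <= size q)%N.
  have [q0|q0] := eqVneq q 0; first by move: r0; rewrite /r q0 horner0 subrr eqxx.
  rewrite (leq_trans (size_polyD _ _)) // size_polyN geq_max leqnn /=.
  by rewrite (leq_trans (size_polyC_leq1 _)) // size_poly_gt0.
(* The value of [q] at [shift g] is the value at 0 of its translate, that is of [q] itself. So [q -
   q.[0]] has p^2 distinct roots, too many for a nonzero polynomial of size at most p^2. *)
apply: leq_trans sz_r; rewrite -card_Zp2 cardT.
rewrite -(size_map (fun g => (shift g)%:MP_[2])); apply: max_poly_roots => //.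
  apply/allP => _ /mapP[g _ ->]; rewrite /root hornerD hornerN hornerC.
  rewrite -{2}(invq g) [(translate _ _).[_]]horner_comp.
  by rewrite hornerD hornerX hornerC add0r subrr.
rewrite map_inj_uniq ?enum_uniq // => g h /eqP; rewrite mpolyC_eq => /eqP.
exact: shift_inj.
Qed.

(** The condition under which Euclidean division by [W] exists and is unique although [D] is not a
    field. *)
Definition unit_lead (W : {poly D}) (n : nat) : Prop :=
  size W = n.+1 /\ lead_coef W \is a GRing.unit.

Lemma unit_lead_neq0 W n : unit_lead W n -> W != 0.
Proof. by case=> szW _; rewrite -size_poly_gt0 szW. Qed.

Lemma unit_leadM W V m n :
  unit_lead W m -> unit_lead V n -> unit_lead (W * V) (m + n)%N.
Proof.
move=> uW uV; have W0 := unit_lead_neq0 _ _ uW; have V0 := unit_lead_neq0 _ _ uV.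
case: uW uV => [szW uW] [szV uV]; split; last by rewrite lead_coefM unitrM uW.
by rewrite size_mul // szW szV addnS.
Qed.

Lemma unit_lead_cst c : c != 0 -> unit_lead (cst c) 0.
Proof.
move=> c0; split; first by rewrite size_polyC mpolyC_eq0 c0.
by rewrite lead_coefC; apply: rmorph_unit; rewrite unitfE.
Qed.

Lemma unit_leadX W m k : unit_lead W m -> unit_lead (W ^+ k) (m * k)%N.
Proof.
move=> uW; elim: k => [|k IH]; last by rewrite exprS mulnS; apply: unit_leadM.
by rewrite muln0 expr0 -(rmorph1 cst); apply/unit_lead_cst/oner_neq0.
Qed.

Lemma unit_leadD (W V : {poly D}) m :
  unit_lead W m -> (size V <= m)%N -> unit_lead (W + V) m.
Proof.
move=> [szW uW] szV; split; first by rewrite size_polyDl szW.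
by rewrite lead_coefDl // szW.
Qed.

Lemma size_translate c W : size (translate c W) = size W.
Proof. by rewrite size_comp_poly2 // size_XaddC. Qed.

Lemma unit_lead_translate c W m : unit_lead W m -> unit_lead (translate c W) m.
Proof.
case=> szW uW; split; first by rewrite size_translate.
by rewrite lead_coef_comp ?size_XaddC // lead_coefXaddC expr1n mulr1.
Qed.

Lemma unit_leadN W m : unit_lead W m -> unit_lead (- W) m.
Proof. by case=> szW uW; split; rewrite ?size_polyN // lead_coefN unitrN. Qed.

Lemma unit_lead_Y : unit_lead 'X 1.
Proof. by split; rewrite ?size_polyX // lead_coefX unitr1. Qed.

Lemma size_cstM c (W : {poly D}) : (size (cst c * W)%R <= size W)%N.
Proof. by rewrite mul_polyC size_scale_leq. Qed.

Hypothesis g12_neq0 : g12 != 0.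

Lemma unit_lead_delta : unit_lead deltaD p.
Proof.
have -> : deltaD = cst (- g13^-1 * g12) * 'X ^+ p
    + cst g13^-1 * (uD - cst g23 * 'X).
  rewrite rmorphM rmorphN /= /deltaD; ring.
apply: unit_leadD.
  rewrite -[p in unit_lead _ p]add0n -[p in (0 + p)%N]mul1n.
  apply/unit_leadM/unit_leadX/unit_lead_Y/unit_lead_cst.
  by rewrite mulf_neq0 // oppr_eq0 invr_eq0.
apply: leq_trans (size_cstM _ _) _; apply: leq_trans (size_polyD _ _) _.
rewrite size_polyN geq_max (leq_trans (size_polyC_leq1 _)) //=.
by rewrite (leq_trans (size_cstM _ _)) // size_polyX ltnW.
Qed.

Lemma unit_lead_zeta : unit_lead zetaD p.
Proof.
(* As p > 2, the term [- deltaD] of degree p dominates Y^2. *)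
rewrite /zetaD addrC; apply: unit_leadD; last by rewrite size_polyXn.
exact/unit_leadN/unit_lead_delta.
Qed.

Lemma unit_lead_f124 : unit_lead f124D (p ^ 2).
Proof.
have le_p2 : (p.+1 <= p ^ 2)%N by rewrite -mulnn; nia.
rewrite /f124D -addrA; apply: unit_leadD.
  rewrite -[(p ^ 2)%N]add0n -mulnn; apply/unit_leadN/unit_leadM.
    exact: unit_lead_cst.
  exact/unit_leadX/unit_lead_delta.
apply: leq_trans (size_polyD _ _) _; rewrite geq_max.
have [sz_delta _] := unit_lead_delta.
rewrite (leq_trans (size_cstM _ _)) ?sz_delta //=.
rewrite (leq_trans (size_cstM _ _)) // size_polyX; lia.
Qed.

Lemma unit_lead_f2 : unit_lead f2D (p ^ 2).
Proof.
rewrite /f2D -[(p ^ 2)%N]add0n; apply: unit_leadM.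
  by apply: unit_lead_cst; rewrite invr_eq0 two_neq0.
apply: unit_leadD; last first.
  by rewrite -rmorphXn (leq_trans (size_polyC_leq1 _)) // expn_gt0 p_gt0.
rewrite -[(p ^ 2)%N]add0n; apply: unit_leadM; first exact: unit_lead_cst.
exact: unit_lead_f124.
Qed.

(** There are p^2 factors, all translates of [zetaD], of degree p each. *)
Lemma unit_lead_N : unit_lead ND (p ^ 3).
Proof.
rewrite expnS -card_Zp2 cardE /ND -big_enum /= mulnC.
elim: (enum _) => [|g s IH].
  by rewrite big_nil -(rmorph1 cst); apply/unit_lead_cst/oner_neq0.
rewrite big_cons mulSn; apply: unit_leadM => //.
exact/unit_lead_translate/unit_lead_zeta.
Qed.

(* W lies in the span over K[x, 1/x, f_1, N] of 1, f_2, ..., f_2^(p-1). *)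
Definition spanned (W : {poly D}) : Prop := exists (n : nat) (Q : {mpoly K[4]}),
  low_degree 2 p Q /\ xD ^+ n * W = chart (Q \mPo gens p X).

Lemma chart_gens_var (i : 'I_4) :
  chart ('X_i \mPo gens p X) = chart (tnth (gens p X) i).
Proof. by rewrite comp_mpolyXU (tnth_nth 0). Qed.

(** A generator other than f_2 leaves the degree in f_2 unchanged, and the factor x^n between it and
    [V] is absorbed by the power of x. *)
Lemma spannedM (i : 'I_4) n V W : i != 2 ->
  chart (tnth (gens p X) i) = xD ^+ n * V -> spanned W -> spanned (V * W).
Proof.
move=> i2 iE [m [Q [lowQ QE]]]; exists (m + n)%N, (Q * 'X_i); split.
  by apply: low_degreeMX; rewrite // mnm1E (negPf i2).
rewrite rmorphM rmorphM /= chart_gens_var iE -QE exprD; ring.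
Qed.

Lemma spanned_cst c W : spanned W -> spanned (cst c * W).
Proof.
move=> [m [Q [lowQ QE]]]; exists m, (c *: Q); split; first exact: low_degreeZ.
rewrite comp_mpolyZ chartZ -QE; ring.
Qed.

Lemma spanned_x W : spanned W -> spanned (xD * W).
Proof. by apply: (spannedM 0 0); rewrite // expr0 mul1r; apply: chart_x. Qed.

Lemma spanned_u W : spanned W -> spanned (uD * W).
Proof. by apply: (spannedM 1 p) => //; apply: chart_f1. Qed.

Lemma spanned_N W : spanned W -> spanned (ND * W).
Proof. by apply: (spannedM 3 (p ^ 2)) => //; apply: chart_N. Qed.

Lemma spanned0 : spanned 0.
Proof.
exists 0%N, 0; split; first by move=> I; rewrite msupp0.
by rewrite comp_mpoly0 rmorph0 mulr0.
Qed.

Lemma spannedD W V : spanned W -> spanned V -> spanned (W + V).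
Proof.
move=> [m [Q [lowQ QE]]] [n [R [lowR RE]]].
exists (m + n)%N, (Q * 'X_[U_(0) *+ n] + R * 'X_[U_(0) *+ m]); split.
  by apply: low_degreeD; apply: low_degreeMX; rewrite // mulmnE mnm1E.
have xE k : chart ('X_[U_(0) *+ k] \mPo gens p X) = xD ^+ k.
  by rewrite -mpolyXn !rmorphXn /= chart_gens_var -chart_x.
rewrite !rmorphD !rmorphM /= !xE -QE -RE exprD; ring.
Qed.

Lemma spanned_f2X j : (j < p)%N -> spanned (f2D ^+ j).
Proof.
move=> lt_jp; exists ((p + 2) * j)%N, ('X_[U_(2) *+ j]); split.
  by move=> I; rewrite msuppX inE => /eqP->; rewrite mulmnE mnm1E mul1n.
rewrite -mpolyXn !rmorphXn /= chart_gens_var exprM -exprMn; congr (_ ^+ _).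
exact/esym/chart_f2.
Qed.

Lemma spanned_polyC (q : D) W : spanned W -> spanned (q%:P * W).
Proof.
move=> spW; elim/mpolyind: q => [|c m q _ _ IH].
  by rewrite polyC0 mul0r; apply: spanned0.
rewrite polyCD mulrDl; apply: spannedD; last exact: IH.
rewrite -mul_mpolyC polyCM -mulrA; apply: spanned_cst.
rewrite mpolyXE_id !big_ord_recl big_ord0 mulr1 polyCM !polyC_exp -mulrA.
elim: (m ord0) => [|k IHk]; last by rewrite exprS -mulrA; apply: spanned_x.
rewrite expr0 mul1r; have -> : lift ord0 ord0 = 1 :> 'I_2 by apply: val_inj.
elim: (m 1) => [|k IHk]; last by rewrite exprS -mulrA; apply: spanned_u.
by rewrite expr0 mul1r.
Qed.

Lemma spanned_basis (q : D) j k :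
  (j < p)%N -> spanned (q%:P * (f2D ^+ j * ND ^+ k)).
Proof.
move=> lt_jp; apply: spanned_polyC; rewrite mulrC.
elim: k => [|k IH]; first by rewrite expr0 mul1r; apply: spanned_f2X.
by rewrite exprS -mulrA; apply: spanned_N.
Qed.

(** Induction on the degree in Y: [W] is divided by a product [G] of powers of f_2 and N whose
    degree is the largest multiple of p^2 not above that of [W]. The quotient has degree below p^2,
    so it does not involve Y. *)
Lemma invariantD_spanned W : invariantD W -> spanned W.
Proof.
have [n] := ubnP (size W); elim: n W => // n IH W; rewrite ltnS => le_Wn invW.
have [->|W0] := eqVneq W 0; first exact: spanned0.
(* With t = j + p k and j < p, the product f_2^j N^k has degree p^2 j + p^3 k = p^2 t. *)
set d := (size W).-1; pose t := (d %/ p ^ 2)%N.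
pose G := f2D ^+ (t %% p) * ND ^+ (t %/ p).
have p2_gt0 : (0 < p ^ 2)%N by rewrite expn_gt0 p_gt0.
have uG : unit_lead G (p ^ 2 * t).
  rewrite {1}(divn_eq t p) mulnDr addnC [(t %/ p * p)%N]mulnC mulnA -expnSr.
  by apply: unit_leadM; apply: unit_leadX;
    [apply: unit_lead_f2 | apply: unit_lead_N].
have invG : invariantD G.
  by apply: invariantDM; apply: invariantDX;
    [apply: f2D_invariant | apply: ND_invariant].
have G0 := unit_lead_neq0 _ _ uG.
have WE := Pdiv.IdomainUnit.divp_eq (proj2 uG) W.
set q := (W %/ G) in WE; set r := (W %% G) in WE.
have lt_rG : (size r < size G)%N by rewrite ltn_modp.
(* Translating the division of [W] by [G] gives another division of [W] by [G], so uniqueness makes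
   quotient and remainder invariant. *)
have inv_qr g : translate (shift g) q = q /\ translate (shift g) r = r.
  have WgE : W = translate (shift g) q * G + translate (shift g) r.
    by rewrite -[LHS](invW g) {1}WE rmorphD rmorphM /= invG.
  apply: (Pdiv.IdomainUnit.edivpP (proj2 uG) WgE).
  by rewrite size_translate.
have sz_q : (size q <= p ^ 2)%N.
  rewrite /q size_divp // (proj1 uG) /=.
  rewrite leq_subLR (polySpred W0) -/d /t mulnC [X in (X < _)%N](divn_eq d (p ^ 2)).
  by rewrite ltn_add2l ltn_pmod.
have sz_GW : (size G <= size W)%N.
  by rewrite (proj1 uG) (polySpred W0) ltnS mulnC leq_trunc_div.
rewrite WE (small_invariantD q) //; last by move=> g; case: (inv_qr g).
apply: spannedD; first by apply: spanned_basis; rewrite ltn_mod.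
apply: IH; last by move=> g; case: (inv_qr g).
exact: leq_trans (leq_trans lt_rG sz_GW) le_Wn.
Qed.

Lemma invariant_spanned F : G_invariant p X F -> exists n Q,
  low_degree 2 p Q /\ xV ^+ n * F = Q \mPo gens p X.
Proof.
move=> /G_invariantP/invariantD_spanned[n [Q [lowQ QE]]]; exists n, Q.
by split=> //; apply: chart_inj; rewrite -QE rmorphM rmorphXn /= chart_x.
Qed.

(** * Lead monomials of the generators *)

Lemma grevlex_lt_x (m1 m2 : 'X_{1..3}) : mdeg m1 = mdeg m2 ->
  (m2 0%R < m1 0%R)%N -> grevlex_lt m1 m2.
Proof.
move=> dE lt0; rewrite /grevlex_lt dE eqxx ltnn /=; apply/existsP; exists 0.
by rewrite lt0; apply/forallP.
Qed.

(** As x is the smallest variable, any monomial divisible by x lies below the power of y of the same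
    degree. *)
Lemma supp_lt_xM (H : {mpoly K[3]}) d :
  H \is d.-homog -> supp_lt (xV * H) (U_(1) *+ d.+1)%MM.
Proof.
move=> /dhomogP homH m; rewrite mulrC (perm_mem (msuppMX _ _)).
case/mapP=> m' m'H ->; apply: grevlex_lt_x.
  by rewrite mdegD mdegMn !mdeg1 mul1n (homH _ m'H) add1n.
by rewrite mnmDE mulmnE !mnm1E.
Qed.

Lemma supp_le_yx (F H : {mpoly K[3]}) c d n :
  n = d.+1 -> H \is d.-homog -> F = c *: yV ^+ n + xV * H ->
  supp_le F (U_(1) *+ n)%MM /\ F@_(U_(1) *+ n) = c.
Proof.
move=> -> homH ->; have lt_xH := supp_lt_xM _ _ homH; split.
  apply: supp_leD; last exact: supp_lt_le.
  by apply: supp_leZ; rewrite /yV mpolyXn; apply: supp_leX.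
by rewrite mcoeffD (supp_lt_coeff _ _ lt_xH) mcoeffZ mcoeffXn eqxx mulr1 addr0.
Qed.

Lemma homogM (F H : {mpoly K[3]}) d e n : n = (d + e)%N ->
  F \is d.-homog -> H \is e.-homog -> F * H \is n.-homog.
Proof. by move=> ->; apply: dhomogM. Qed.

Lemma homog_varX (i : 'I_3) k : ('X_i : {mpoly K[3]}) ^+ k \is k.-homog.
Proof. by rewrite mpolyXn dhomogX /= mdegMn mdeg1 mul1n. Qed.

Lemma homog_var (i : 'I_3) : ('X_i : {mpoly K[3]}) \is 1.-homog.
Proof. by rewrite dhomogX /= mdeg1. Qed.

Lemma homog_delta : (delta : {mpoly K[3]}) \is 2.-homog.
Proof.
by rewrite /delta rpredB // ?homog_varX // (homogM _ _ 1 1) ?homog_var.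
Qed.

Lemma f1_lead : supp_le (f1 p X) (U_(1) *+ p)%MM /\ (f1 p X)@_(U_(1) *+ p) = g12.
Proof.
(* Writing p = q + 3 exposes a factor x in x^(p-2), so that everything but gamma_12 y^p is x times a
   polynomial. *)
have [q pE] : exists q, p = q.+3 by exists (p - 3)%N; lia.
pose H : {mpoly K[3]} := g13 *: (delta * xV ^+ q) + g23 *: (yV * xV ^+ q.+1).
apply: (supp_le_yx _ H _ _ _ pE).
  rewrite rpredD // rpredZ //.
    exact: (homogM _ _ 2 q _ erefl homog_delta (homog_varX _ _)).
  exact: (homogM _ _ 1 q.+1 _ erefl (homog_var _) (homog_varX _ _)).
rewrite /f1 /H -!mul_mpolyC.
have -> : (p - 2 = q.+1)%N by lia.
have -> : (p - 1 = q.+2)%N by lia.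
rewrite !exprS; ring.
Qed.

Lemma f2_lead : supp_le (f2 p X) (U_(1) *+ (p + 2))%MM /\
  (f2 p X)@_(U_(1) *+ (p + 2)) = g12 * g13.
Proof.
have [q pE] : exists q, p = q.+3 by exists (p - 3)%N; lia.
have pV : p \in [pchar {mpoly K[3]}] := rmorph_pchar (mpolyC 3 (R := K)) pK.
have deltaX : delta ^+ p = (yV ^+ p) ^+ 2 - xV ^+ p * zV ^+ p :> {mpoly K[3]}.
  have frobB (u v : {mpoly K[3]}) : (u - v) ^+ p = u ^+ p - v ^+ p.
    exact: (rmorphB (pFrobenius_aut pV)).
  by rewrite /delta frobB (exprMn p xV) exprAC.
(* In the quotient given by [f2_identity], 2 gamma_12 gamma_13 y^p delta contributes 2 gamma_12
   gamma_13 y^(p+2) and a multiple of x; [B] is what remains beyond that power of y, divided by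
   x. *)
pose B : {mpoly K[3]} := ((g12 ^+ 2) *: (xV * zV ^+ p)
  + (g12 * g14) *: (delta * xV ^+ q.+2) + (g12 * g24) *: (yV * xV ^+ p)
  + (2 * g12) *: (yV ^+ p * (g23 *: yV - g13 *: zV))
  + xV ^+ q * (g13 *: delta + g23 *: (yV * xV)) ^+ 2).
apply: (supp_le_yx _ (2^-1 *: B) _ _ _ (addn2 p)).
  have homy := homog_var 1; have homx := homog_var 0; have homz := homog_var 2.
  have homd : g13 *: delta + g23 *: (yV * xV) \is [in K[3], 2.-homog].
    by rewrite rpredD // rpredZ ?homog_delta // (homogM _ _ 1 1).
  have homl : g23 *: yV - g13 *: zV \is [in K[3], 1.-homog].
    by rewrite rpredB // rpredZ.
  rewrite rpredZ // !rpredD // ?rpredZ //.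
  - exact: (homogM _ _ 1 p _ erefl homx (homog_varX _ _)).
  - by apply: (homogM _ _ 2 q.+2 _ _ homog_delta (homog_varX _ _)); lia.
  - exact: (homogM _ _ 1 p _ erefl homy (homog_varX _ _)).
  - by apply: (homogM _ _ p 1 _ _ (homog_varX _ _) homl); lia.
  - apply: (homogM _ _ q 4 _ _ (homog_varX _ _)); first by lia.
    by rewrite expr2; apply: (homogM _ _ 2 2).
have x0 : 2 *: xV ^+ (p - 2) != 0 :> {mpoly K[3]}.
  rewrite scaler_eq0 negb_or two_neq0 /= expf_neq0 //.
  by rewrite -msize_poly_eq0 msizeX.
apply: (mulfI x0); rewrite -[LHS]scalerAl f2_exact // /f124 deltaX /f1.
have half (u v w : {mpoly K[3]}) :
    2 *: u * (v + xV * (2^-1 *: w)) = (2 *: v + xV * w) * u.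
  have h2 : 2%:MP * (2^-1)%:MP = 1 :> {mpoly K[3]}.
    by rewrite -mpolyCM mulfV ?two_neq0 // mpolyC1.
  rewrite -!mul_mpolyC.
  have -> : 2%:MP * u * (v + xV * (2^-1%:MP * w)) =
    (2%:MP * v + xV * w * (2%:MP * 2^-1%:MP)) * u by ring.
  by rewrite h2 mulr1.
rewrite half.
rewrite -!mul_mpolyC f2_identity; last by apply: ltnW.
congr (_ * _); rewrite /B -!mul_mpolyC !(rmorphXn, rmorph_nat, rmorphM) /=.
have -> : (p - 2 = q.+1)%N by lia.
rewrite [in xV ^+ p]pE [in p.+1]pE addn2 !exprS /delta; ring.
Qed.

Lemma act_z_lead (g : 'Z_p * 'Z_p) : is_lead_monomial (act X zV g) U_(2).
Proof.
have [e ->] := act_z g; apply/is_lead_suppP; split.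
  rewrite !mcoeffD !mcoeffZ !mcoeffXU /= !mulr0 !addr0; exact: oner_neq0.
have lt_var i : i != 2 -> grevlex_lt (U_(i) : 'X_{1..3}) U_(2).
  move=> i2; rewrite /grevlex_lt !mdeg1 /=; apply/existsP; exists i.
  rewrite !mnm1E eqxx eq_sym (negPf i2) /=; apply/forallP => j.
  apply/implyP => lt_ji; rewrite !mnm1E.
  have /negPf-> : i != j by apply: contraTneq lt_ji => ->; rewrite ltnn.
  case: (eqVneq (2 : 'I_3) j) lt_ji => // <-.
  by rewrite ltnNge -ltnS ltn_ord.
have le_var i c : i != 2 -> supp_le (c *: 'X_i : {mpoly K[3]}) U_(2).
  move=> i2; apply/supp_leZ/supp_lt_le; apply: supp_lt_trans (lt_var i i2).
  exact: supp_leX.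
apply: supp_leD; last exact: le_var.
apply: supp_leD; [exact: supp_leX | exact: le_var].
Qed.

Definition gens_lead (i : 'I_4) : 'X_{1..3} :=
  nth 0%MM [:: U_(0%R); U_(1) *+ p; U_(1) *+ (p + 2)%N; U_(2) *+ (p ^ 2)%N]%MM i.

Lemma N_lead : is_lead_monomial (NGz p X) (U_(2) *+ (p ^ 2)%N)%MM.
Proof.
have -> : (U_(2) *+ (p ^ 2)%N = \sum_(g : 'Z_p * 'Z_p) U_(2) :> 'X_{1..3})%MM.
  apply/mnmP => i.
  by rewrite mnm_sumE sum_nat_const card_Zp2 mulmnE mulnC.
by rewrite NGzE; apply: is_lead_prod => g; apply: act_z_lead.
Qed.

Lemma ord4_cases (i : 'I_4) : [\/ i = 0, i = 1, i = 2 | i = 3].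
Proof.
case: i => -[|[|[|[|//]]]] h;
  [apply: Or41|apply: Or42|apply: Or43|apply: Or44]; exact: val_inj.
Qed.

Lemma gens_is_lead i : is_lead_monomial (tnth (gens p X) i) (gens_lead i).
Proof.
case: (ord4_cases i) => ->; rewrite (tnth_nth 0) /gens_lead /=.
- exact: is_leadX.
- by apply/is_lead_suppP; have [le_f1 ->] := f1_lead.
- by apply/is_lead_suppP; have [le_f2 ->] := f2_lead; rewrite mulf_neq0.
- exact: N_lead.
Qed.

Lemma gens_invariant i : G_invariant p X (tnth (gens p X) i).
Proof.
case: (ord4_cases i) => ->; rewrite (tnth_nth 0) /=.
- by apply/G_invariantP; rewrite chart_x; apply: invariantD_polyC.
- exact: f1_invariant.
- exact: f2_invariant.
- exact: NGz_invariant.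
Qed.

(** * Lead exponents of products of the generators *)

Notation gens_exp := (lead_exp (l := gens_lead)).

Lemma gens_expE (I : 'X_{1..4}) :
  [/\ gens_exp I 0 = I 0, gens_exp I 1 = (p * I 1%R + (p + 2) * I 2%R)%N
    & gens_exp I 2 = (p ^ 2 * I 3%R)%N].
Proof.
have E (j : 'I_3) : gens_exp I j = (gens_lead 0%R j * I 0%R +
    gens_lead 1%R j * I 1%R + gens_lead 2%R j * I 2%R + gens_lead 3%R j * I 3%R)%N.
  rewrite mnm_sumE !big_ord_recl big_ord0 addn0 !(mulmnE (gens_lead _)) !addnA.
  by congr (gens_lead _ j * I _ + gens_lead _ j * I _ + gens_lead _ j * I _
    + gens_lead _ j * I _)%N; apply: val_inj.
by split; rewrite E /gens_lead /= ?mulmnE !mnm1E /=; lia.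
Qed.

Lemma gens_exp_inj (I J : 'X_{1..4}) : (I 2%R < p)%N -> (J 2%R < p)%N ->
  gens_exp I = gens_exp J -> I = J.
Proof.
move=> lt_I lt_J IJ; have [I0 I1 I2] := gens_expE I.
have [J0 J1 J2] := gens_expE J; rewrite IJ in I0 I1 I2.
have E0 : I 0%R = J 0%R by rewrite -I0 J0.
have E3 : I 3%R = J 3%R.
  have /eqP : (p ^ 2 * I 3%R = p ^ 2 * J 3%R)%N by rewrite -I2 J2.
  by rewrite eqn_pmul2l ?expn_gt0 ?p_gt0 // => /eqP.
have E1 : (p * I 1%R + (p + 2) * I 2%R = p * J 1%R + (p + 2) * J 2%R)%N.
  by rewrite -I1 J1.
(* Modulo p the exponent of y is twice the exponent of f_2, which is below p and hence determined, p
   being odd; the comparison is made in [K]. *)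
have E2 : I 2%R = J 2%R.
  apply: natr_inj_mod => //; apply: (mulfI two_neq0).
  have := congr1 (fun n => n%:R : K) E1.
  by rewrite !natrD !natrM !natrD (pcharf0 pK) !mul0r !add0r.
have {E1}E1 : I 1%R = J 1%R.
  by move/eqP: E1; rewrite E2 eqn_add2r eqn_pmul2l // => /eqP.
by apply/mnmP => i; case: (ord4_cases i) => ->.
Qed.

(** The products in [Q] have distinct lead monomials, so one of them carries the lead monomial of
    x^n F. Only the generator x contributes to the exponent of x, so x^n can be taken out of that
    product. *)
Lemma invariant_lead F m : G_invariant p X F -> is_lead_monomial F m ->
  exists I, m = gens_exp I.
Proof.
move=> invF lead_F; have [n [Q [lowQ QE]]] := invariant_spanned F invF.
have lead_xF : is_lead_monomial (Q \mPo gens p X) (U_(0%R) *+ n + m)%MM.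
  by rewrite -QE; apply: is_leadM => //; apply/is_lead_exp/is_leadX.
have Q0 : Q != 0.
  have := is_lead_neq0 _ _ lead_xF; apply: contraNneq => ->.
  by rewrite comp_mpoly0.
have [I J /lowQ lt_I /lowQ lt_J|I IQ lead_I] :=
    lead_exp_comb gens_is_lead Q _ Q0; first exact: gens_exp_inj.
have IE := is_lead_uniq _ _ _ lead_xF lead_I.
have le_nI : (U_(0%R) *+ n <= I)%MM.
  have [I0 _ _] := gens_expE I.
  have : (n <= I 0%R)%N.
    by rewrite -I0 -IE mnmDE mulmnE mnm1E eqxx mul1n leq_addr.
  move=> le_n; apply/mnm_lepP => i; rewrite mulmnE mnm1E.
  by case: eqVneq => [<-|]; rewrite ?mul1n.
exists (I - U_(0%R) *+ n)%MM; apply: (@addmI _ (U_(0%R) *+ n)%MM).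
rewrite IE -{1}(submK le_nI) lead_expD addmC; congr (_ + _)%MM.
have [E0 E1 E2] := gens_expE (U_(0%R) *+ n)%MM.
by apply/mnmP => i; case: (ord3_cases i) => ->; rewrite ?E0 ?E1 ?E2 !mulmnE;
  rewrite !mnm1E /=; lia.
Qed.

(** * The algebra of invariants and the relation from the tête-à-tête *)

Lemma invariant_const c : G_invariant p X c%:MP.
Proof.
by apply/G_invariantP => g; rewrite chartC translate_cst.
Qed.

Lemma invariantD_closed F H :
  G_invariant p X F -> G_invariant p X H -> G_invariant p X (F + H).
Proof.
move=> /G_invariantP invF /G_invariantP invH; apply/G_invariantP.
rewrite rmorphD; apply: invariantDD; [exact: invF | exact: invH].
Qed.

Lemma invariantM_closed F H :
  G_invariant p X F -> G_invariant p X H -> G_invariant p X (F * H).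
Proof.
move=> /G_invariantP invF /G_invariantP invH; apply/G_invariantP.
rewrite rmorphM; apply: invariantDM; [exact: invF | exact: invH].
Qed.

Lemma mcoeffX_supp_le (F : {mpoly K[3]}) m k : supp_le F m ->
  supp_le (F ^+ k) (m *+ k)%MM /\ (F ^+ k)@_(m *+ k) = F@_m ^+ k.
Proof.
move=> le_F; elim: k => [|k [le_Fk Fk]].
  by rewrite mulm0n !expr0 -mpolyX0 mcoeffX eqxx; split=> //; apply: supp_leX.
rewrite mulmS exprS mcoeffM_supp_le // Fk exprS; split=> //.
exact: supp_leM.
Qed.

(** Both terms have coefficient gamma_13^p gamma_12^(p+2) at y^(p(p+2)), so these cancel in the
    difference. *)
Lemma tete_supp_lt :
  supp_lt (tete p X \mPo gens p X) (U_(1) *+ (p * (p + 2)))%MM.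
Proof.
rewrite /tete comp_mpolyB !comp_mpolyZ !rmorphXn /= !comp_mpolyXU /=.
have [le_f1 c_f1] := f1_lead; have [le_f2 c_f2] := f2_lead.
have [le_f1X c_f1X] := mcoeffX_supp_le _ _ (p + 2) le_f1.
have [le_f2X c_f2X] := mcoeffX_supp_le _ _ p le_f2.
have mE m k n : (U_(1) *+ m *+ k = U_(1) *+ (m * k) :> 'X_{1..n.+2})%MM.
  by apply/mnmP => i; rewrite !mulmnE mulnA.
rewrite !mE [((p + 2) * p)%N]mulnC in le_f1X c_f1X le_f2X c_f2X.
apply/supp_ltP; split.
  by rewrite -scaleNr; apply: supp_leD; apply: supp_leZ.
rewrite mcoeffB !mcoeffZ c_f1X c_f2X c_f1 c_f2 exprMn exprD; ring.
Qed.

(** All subtracted products lie below y^(p(p+2)), so none is divisible by f_2^p. Hence the relation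
    has degree p in the variable of f_2, with lead coefficient - gamma_12^2. *)
Lemma tete_relation R : subduction_relation (gens p X) (tete p X) R ->
  generates_relations (gens p X) R.
Proof.
move=> [T [sub_T ->]].
have ->: tete p X - T = - g12 ^+ 2 *: 'X_2 ^+ p + (g13 ^+ p *: 'X_1 ^+ (p + 2) - T).
  by rewrite /tete scaleNr; ring.
apply: (generates_relations_of_monic gens_is_lead).
- exact: gens_exp_inj.
- by rewrite oppr_eq0 expf_neq0.
- apply: low_degreeD.
    by apply: low_degreeZ => I; rewrite mpolyXn msuppX inE => /eqP->;
      rewrite mulmnE mnm1E.
  rewrite -scaleN1r; apply: low_degreeZ => I IT; rewrite ltnNge.
  apply/negP => le_pI; have := subducts_supp_lt gens_is_lead _ _ _ _ sub_T
    tete_supp_lt I IT.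
  have le_I : (U_(2) *+ p <= I)%MM.
    apply/mnm_lepP => i; rewrite mulmnE mnm1E.
    by case: eqVneq => [<-|]; rewrite ?mul1n.
  (* The bound is itself the lead monomial of f_2^p, so a product divisible by f_2^p cannot lie
     below it. *)
  have -> : (U_(1) *+ (p * (p + 2)))%MM = gens_exp (U_(2) *+ p)%MM.
    have [E0 E1 E2] := gens_expE (U_(2) *+ p)%MM.
    by apply/mnmP => i; case: (ord3_cases i) => ->; rewrite ?E0 ?E1 ?E2 !mulmnE;
      rewrite !mnm1E /=; lia.
  rewrite -{1}(submK le_I) lead_expD addmC => lt_I.
  have := grevlex_le_lt_trans _ _ _ (grevlex_le_addr _ _) lt_I.
  by rewrite grevlex_irr.
rewrite addrA.
have -> : - g12 ^+ 2 *: 'X_2 ^+ p + g13 ^+ p *: 'X_1 ^+ (p + 2) = tete p X.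
  by rewrite /tete addrC scaleNr.
by rewrite comp_mpolyB (subducts_comp _ _ _ sub_T) subr0 subrr.
Qed.

Lemma sagbi_of_gam_neq0 :
  is_sagbi_basis (G_invariant p X) (gens p X) /\
  (exists R : {mpoly K[4]}, subduction_relation (gens p X) (tete p X) R) /\
  (forall R : {mpoly K[4]}, subduction_relation (gens p X) (tete p X) R ->
    generates_relations (gens p X) R).
Proof.
have A_lead := invariant_lead.
have AC := invariant_const; have AD := invariantD_closed.
have AM := invariantM_closed; have Ab := gens_invariant.
split; last split; last exact: tete_relation.
  exact: (sagbi_basis gens_is_lead _ AC AM Ab A_lead).
have AP : G_invariant p X (tete p X \mPo gens p X).
  exact: (subalgebra_comp _ AC AD AM Ab).
have [T sub_T] := subducts_to0 gens_is_lead _ AC AD AM Ab A_lead _ AP.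
by exists (tete p X - T), T.
Qed.

End Chart.

(** * The generic matrix *)

Lemma subX_neq0 (R : nzRingType) (n : nat) (m m' : 'X_{1..n}) :
  m != m' -> 'X_[m] - 'X_[m'] != 0 :> {mpoly R[n]}.
Proof.
move=> ne_m; apply/eqP => /(congr1 (mcoeff m))/eqP.
by rewrite mcoeffB !mcoeffX eqxx [m' == m]eq_sym (negPf ne_m) subr0 mcoeff0 oner_eq0.
Qed.

Lemma mxvec_index_eq (m n : nat) (i i' : 'I_m) (j j' : 'I_n) :
  (mxvec_index i j == mxvec_index i' j') = (i == i') && (j == j').
Proof. by rewrite (inj_eq (@cast_ord_inj _ _ _)) (inj_eq enum_rank_inj). Qed.

Lemma xgen_gam01 (p : nat) : gam p (xgen p) 0 1 != 0.
Proof.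
rewrite gam01E !mxE -!rmorphM -rmorphB /= tofrac_eq0 -!mpolyXD subX_neq0 //.
(* The indeterminate x_11 divides x_11 x_22 but not x_12 x_21. *)
apply/eqP => /mnmP/(_ (mxvec_index 0 0)).
by rewrite !mnmDE !mnm1E !mxvec_index_eq.
Qed.

Lemma xgen_gam02 (p : nat) : (1 < p)%N -> gam p (xgen p) 0 2 != 0.
Proof.
move=> p_gt1; rewrite gam02E !mxE -!rmorphXn -!rmorphM -rmorphB /= tofrac_eq0.
rewrite !mpolyXn -!mpolyXD subX_neq0 //.
(* The exponents of x_11 in the two terms of gamma_13 are 1 and p. *)
apply/eqP => /mnmP/(_ (mxvec_index 0 0)).
rewrite !mnmDE !mulmnE !mnm1E !mxvec_index_eq /=; lia.
Qed.

Theorem theorem7p2 (p : nat) (p_pr : prime p) (p_gt2 : (2 < p)%N) :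
  let X := xgen p in
  let B := gens p X in
  is_sagbi_basis (G_invariant p X) B /\
  (exists R : {mpoly (kgen p)[4]}, subduction_relation B (tete p X) R) /\
  (forall R : {mpoly (kgen p)[4]},
     subduction_relation B (tete p X) R -> generates_relations B R).
Proof.
apply: sagbi_of_gam_neq0 => //; first exact/xgen_gam02/ltnW.
  exact: pchar_kgen.
exact: xgen_gam01.
Qed.
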